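(* Let $n\in\mathbb N$, $k_i\in\mathbb N$, $\sigma_i\in\mathcal P(\mathbb N)$, $i=1,\dots,n$, and put $\vec k=(k_1,\dots,k_n)$, $\vec\sigma=(\sigma_1,\dots,\sigma_n)$. Let $\phi$ be a state on $\mathbb C[Y]$ and $\widehat\phi$ the associated state on $\widehat{\mathcal B}$. Suppose that $\widehat\phi(X_{k_i}(\sigma_i))=0$ and $\widehat\phi(X_{k_i}(\sigma_i)^2)=1$ for $i=1,\dots,n$. If $n$ is even, then $$\lim_{N\to\infty}\widehat\phi^{\star N}\circ D_{1/\sqrt N}\big(X_{k_1}(\sigma_1)\cdots X_{k_n}(\sigma_n)\big)=\big|\mathcal P_n^{\rm pair}(\vec k,\vec\sigma)\big| ,$$ and, if $n$ is odd, the limit vanishes.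
   Context: $\mathbb N=\{1,2,\dots\}$; $\mathcal P(\mathbb N)$ is its power set. A state is a normalized positive linear functional on a unital $*$-algebra. The $*$-bialgebra $\widehat{\mathcal B}$: the unital $*$-algebra over $\mathbb C$ generated by self-adjoint noncommuting elements $X_k(\sigma),P(\sigma)$ ($k\in\mathbb N$, $\sigma\in\mathcal P(\mathbb N)$) subject to $P(\sigma)P(\tau)=P(\sigma\cap\tau)$, $P(\mathbb N)=1$, and $P(\sigma)X_k(\tau)=X_k(\tau)P(\sigma)$ whenever $k\in\sigma$. Its coproduct is the unital $*$-homomorphism with $\widehat\Delta(X_k(\sigma))=X_k(\sigma)\otimes P(\sigma)+P(\sigma)\otimes X_k(\sigma)$, $\widehat\Delta(P(\sigma))=P(\sigma)\otimes P(\sigma)$. Iterations: $\widehat\Delta^0=\mathrm{id}$, $\widehat\Delta^1=\widehat\Delta$, $\widehat\Delta^{N}=(\mathrm{id}\otimes\widehat\Delta^{N-1})\circ\widehat\Delta$. The state $\widehat\phi$: let $\phi$ be a state on $\mathbb C[Y]$, $Y=Y^*$. Its Boolean extension $\widetilde\phi$ is the state on $\mathbb C\langle Y,P\rangle$ (the unital $*$-algebra generated by $Y=Y^*$ and a projection $P=P^*=P^2$) given by linear extension of $\widetilde\phi(1)=\widetilde\phi(P)=1$ and $\widetilde\phi(P^{\alpha}Y^{n_1}PY^{n_2}P\cdots PY^{n_k}P^{\beta})=\phi(Y^{n_1})\cdots\phi(Y^{n_k})$ for $\alpha,\beta\in\{0,1\}$, $n_1,\dots,n_k\in\mathbb N$.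 Let $\mathbb C\langle Y_k,P_k\rangle$ be copies of $\mathbb C\langle Y,P\rangle$ with units $1_k$, and let $\bigotimes_{k\ge1}\mathbb C\langle Y_k,P_k\rangle$ be the infinite tensor product spanned by elementary tensors with all but finitely many components in $\{1_k,P_k\}$. Let $\widehat\eta:\widehat{\mathcal B}\to\bigotimes_{k}\mathbb C\langle Y_k,P_k\rangle$ be the unital $*$-homomorphism sending $X_k(\sigma)$ to the elementary tensor with $Y_k$ at site $k$ and units elsewhere, and $P(\sigma)$ to the elementary tensor with $1_k$ at sites $k\in\sigma$ and $P_k$ at sites $k\notin\sigma$. Then $\widehat\phi=\widetilde\phi^{\otimes\infty}\circ\widehat\eta$. Convolution powers: $\widehat\phi^{\star N}=\widehat\phi^{\otimes N}\circ\widehat\Delta^{N-1}$. Scaling: $D_{1/\sqrt N}$ is the linear map on $\widehat{\mathcal B}$ with $D_{1/\sqrt N}(W)=N^{-d(W)/2}W$ for words $W$ in the generators, where $d(W)$ is the degree of $W$ determined by $d(X_k(\sigma))=1$, $d(P(\sigma))=0$. Adapted partitions: a partition $R=\{R_1,\dots,R_p\}$ of $\{1,\dots,n\}$ is $(\vec k,\vec\sigma)$-adapted if (A1) $k_i=k_j$ whenever $i,j$ lie in the same block, and (A2) if $i<m<j$ with $i,j$ in the same block $R_q$ and $m\notin R_q$, then $k_i=k_j\in\sigma_m$. $\mathcal P_n^{\rm pair}(\vec k,\vec\sigma)$ is the set of $(\vec k,\vec\sigma)$-adapted partitions all of whose blocks have exactly two elements. *)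

(* Defs.v *)
From HB Require Import structures.
From mathcomp Require Import all_boot all_order all_algebra.
From mathcomp Require Import generic_quotient ring_quotient.
From mathcomp Require Import all_classical all_reals.
From mathcomp Require Import topology normedtype.
From mathcomp Require Import complex freeg.

Set Implicit Arguments.
Unset Strict Implicit.
Unset Printing Implicit Defensive.

Import Order.TTheory GRing.Theory Num.Theory.
Import numFieldNormedType.Exports.

Local Open Scope classical_set_scope.
Local Open Scope quotient_scope.
Local Open Scope ring_scope.

Section MonoidAlgebra.
Context (C : numClosedFieldType) (M : starMonoidType).

Definition monalg := {freeg M / C}.
HB.instance Definition _ := GRing.Lmodule.on monalg.

Definition mon (m : M) : monalg := << m >>.

Lemma scale_mon (c : C) m : c *: mon m = << c *g m >>.
Proof. by apply/eqP/freeg_eqP => y; rewrite coeffZ !coeffU mul1r. Qed.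

Lemma monalg_ind (P : monalg -> Prop) :
  P 0 -> (forall c m x, P x -> P (c *: mon m + x)) -> forall x, P x.
Proof.
move=> P0 PD x; rewrite -[x]freeg_sumE.
elim: (dom x) => [|m s IHs]; first by rewrite big_nil.
by rewrite big_cons -scale_mon; exact: PD.
Qed.

Section Lift.
Context (V : lmodType C).

Fact mlift_linear (f : M -> V) : linear (fglift f : monalg -> V).
Proof.
pose g : {additive monalg -> V} :=
  HB.pack (fglift f : monalg -> V)
    (GRing.isZmodMorphism.Build _ _ _ (lift_is_additive f)).
have gZ c m : g (c *: mon m) = c *: f m by rewrite scale_mon; exact: liftU.
move=> c x y; change (g (c *: x + y) = c *: g x + g y).
rewrite raddfD; congr (_ + _).
elim/monalg_ind: x => [|d m x IHx]; first by rewrite scaler0 raddf0 scaler0.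
by rewrite scalerDr !(raddfD g) IHx scalerDr scalerA !gZ scalerA.
Qed.

Definition mlift (f : M -> V) : {linear monalg -> V} :=
  HB.pack (fglift f : monalg -> V)
    (GRing.isLinear.Build C monalg V *:%R _ (mlift_linear f)).

Lemma mlift_mon f m : mlift f (mon m) = f m.
Proof. by rewrite /mon /= liftU scale1r. Qed.

Lemma monalg_ext (f g : {linear monalg -> V}) :
  (forall m, f (mon m) = g (mon m)) -> f =1 g.
Proof.
move=> fg; elim/monalg_ind => [|c m x IHx]; first by rewrite !linear0.
by rewrite !linearP fg IHx.
Qed.

End Lift.

Definition mmul (x y : monalg) : monalg :=
  mlift (fun m => mlift (fun m' => mon (m * m')%g) y) x.

Fact mmul_monl m y :
  mmul (mon m) y = mlift (fun m' => mon (m * m')%g) y.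
Proof. by rewrite /mmul mlift_mon. Qed.

Fact mmul_mon m m' : mmul (mon m) (mon m') = mon (m * m')%g.
Proof. by rewrite mmul_monl mlift_mon. Qed.

Fact mmulPl c x x' y : mmul (c *: x + x') y = c *: mmul x y + mmul x' y.
Proof. by rewrite /mmul linearP. Qed.

Fact mmulPr c x y y' : mmul x (c *: y + y') = c *: mmul x y + mmul x y'.
Proof.
elim/monalg_ind: x => [|d m x IHx].
  by rewrite /mmul !linear0 addr0.
rewrite !mmulPl IHx !mmul_monl linearP !scalerDr addrACA.
by rewrite !scalerA mulrC.
Qed.

Fact mmul0l y : mmul 0 y = 0. Proof. by rewrite /mmul linear0. Qed.
Fact mmul0r x : mmul x 0 = 0.
Proof. by have := mmulPr 1 x 0 0; rewrite !scale1r addr0 => /esym/eqP;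
  rewrite -subr_eq0 addrK => /eqP. Qed.

Fact mmulA : associative mmul.
Proof.
move=> x y z; elim/monalg_ind: x => [|c m x IHx]; first by rewrite !mmul0l.
rewrite !mmulPl IHx; congr (_ *: _ + _).
elim/monalg_ind: y {IHx} => [|d m' y IHy]; first by rewrite !(mmul0l, mmul0r).
rewrite !(mmulPl, mmulPr) IHy; congr (_ *: _ + _).
elim/monalg_ind: z {IHy} => [|e m'' z IHz]; first by rewrite !mmul0r.
by rewrite !mmulPr IHz !mmul_mon mulgA.
Qed.

Fact mmul1l : left_id (mon 1%g) mmul.
Proof.
elim/monalg_ind => [|c m x IHx]; first by rewrite mmul0r.
by rewrite mmulPr IHx mmul_mon mul1g.
Qed.

Fact mmul1r : right_id (mon 1%g) mmul.
Proof.
elim/monalg_ind => [|c m x IHx]; first by rewrite mmul0l.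
by rewrite mmulPl IHx mmul_mon mulg1.
Qed.

Fact mmulDl : left_distributive mmul +%R.
Proof. by move=> x y z; rewrite -{1}[x]scale1r mmulPl scale1r. Qed.

Fact mmulDr : right_distributive mmul +%R.
Proof. by move=> x y z; rewrite -{1}[y]scale1r mmulPr scale1r. Qed.

HB.instance Definition _ :=
  GRing.Zmodule_isPzRing.Build monalg mmulA mmul1l mmul1r mmulDl mmulDr.

Lemma monM m m' : mon m * mon m' = mon (m * m')%g.
Proof. exact: mmul_mon. Qed.

Lemma mon1 : mon 1%g = 1.
Proof. by []. Qed.

Lemma monalg_scaleAl c (x y : monalg) : c *: (x * y) = (c *: x) * y.
Proof. by have := mmulPl c x 0 y; rewrite mmul0l !addr0. Qed.

Lemma monalg_scaleAr c (x y : monalg) : c *: (x * y) = x * (c *: y).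
Proof. by have := mmulPr c x y 0; rewrite mmul0r !addr0. Qed.

(* [monalg] with the conjugate scalar action: a linear map into it is an      *)
(* antilinear map into [monalg].                                              *)
Definition cmonalg := monalg.
HB.instance Definition _ := GRing.Zmodule.on cmonalg.
Definition cscale (c : C) (x : cmonalg) : cmonalg := c^* *: (x : monalg).
Fact cscaleA c d x : cscale c (cscale d x) = cscale (c * d) x.
Proof. by rewrite /cscale scalerA rmorphM. Qed.
Fact cscale1 : left_id 1 cscale.
Proof. by move=> x; rewrite /cscale rmorph1 scale1r. Qed.
Fact cscaleDr : right_distributive cscale +%R.
Proof. by move=> c x y; rewrite /cscale scalerDr. Qed.
Fact cscaleDl x : {morph cscale^~ x : c d / c + d}.
Proof. by move=> c d; rewrite /cscale rmorphD scalerDl. Qed.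
HB.instance Definition _ := GRing.Zmodule_isLmodule.Build C cmonalg
  cscaleA cscale1 cscaleDr cscaleDl.
End MonoidAlgebra.

Section MonoidAlgebraStar.
Context (C : numClosedFieldType) (M : starMonoidType).
Local Notation monalg := (monalg C M).
Implicit Types x y : monalg.

Definition mstar (x : monalg) : monalg :=
  mlift (fun m => mon C (m^-1)%g : cmonalg C M) x.

Lemma mstar_mon m : mstar (mon C m) = mon C (m^-1)%g.
Proof. exact: (@mlift_mon C M (cmonalg C M) _ m). Qed.

Lemma mstarP c x y : mstar (c *: x + y) = c^* *: mstar x + mstar y.
Proof. exact: (@linearP _ _ (cmonalg C M) _ (mlift _) c x y). Qed.

Lemma mstar0 : mstar 0 = 0.
Proof. exact: (@linear0 _ _ (cmonalg C M) _ (mlift _)). Qed.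

Lemma mstarB x y : mstar (x - y) = mstar x - mstar y.
Proof. exact: (@linearB _ _ (cmonalg C M) _ (mlift _) x y). Qed.

Lemma mstarK : involutive mstar.
Proof.
elim/monalg_ind => [|c m x IHx]; first by rewrite !mstar0.
by rewrite !mstarP IHx conjCK !mstar_mon invgK.
Qed.

Lemma mstarM x y : mstar (x * y) = mstar y * mstar x.
Proof.
elim/monalg_ind: x => [|c m x IHx]; first by rewrite !(mul0r, mstar0, mulr0).
rewrite mulrDl -monalg_scaleAl !mstarP IHx mulrDr -monalg_scaleAr.
congr (_ *: _ + _).
elim/monalg_ind: y {IHx} => [|d m' y IHy]; first by rewrite !(mul0r, mstar0, mulr0).
rewrite mulrDr -monalg_scaleAr !mstarP IHy mulrDl -monalg_scaleAl.
by congr (_ *: _ + _); rewrite monM !mstar_mon monM invgM.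
Qed.

End MonoidAlgebraStar.

(* A presentation of a unital *-algebra: the quotient of the monoid *-algebra *)
(* of [monomials] by the *-ideal generated by [relations].                    *)
Record starpres (C : numClosedFieldType) := StarPres {
  monomials : starMonoidType;
  relations : set (monalg C monomials)
}.
Arguments relations {C} s _.

Section PresentedAlgebra.
Context (C : numClosedFieldType) (Q : starpres C).
Local Notation M := (monomials Q).
Local Notation MA := (monalg C M).

Record is_star_ideal (I : set MA) : Prop := {
  star_ideal0 : I 0;
  star_idealB : forall x y, I x -> I y -> I (x - y);
  star_idealMl : forall a x, I x -> I (a * x);
  star_idealMr : forall a x, I x -> I (x * a);
  star_idealS : forall x, I x -> I (mstar x)
}.

Definition star_ideal : set MA := smallest is_star_ideal (relations Q).

Fact is_star_ideal_star_ideal : is_star_ideal star_ideal.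
Proof.
split=> [|x y Ix Iy|a x Ix|a x Ix|x Ix] I HI;
  have idI : is_star_ideal I by case: HI.
- exact: star_ideal0 idI.
- exact: star_idealB idI _ _ (Ix _ HI) (Iy _ HI).
- exact: star_idealMl idI _ _ (Ix _ HI).
- exact: star_idealMr idI _ _ (Ix _ HI).
- exact: star_idealS idI _ (Ix _ HI).
Qed.

Definition star_idealb : {pred MA} := [pred x | `[< star_ideal x >]].

Fact star_idealb_zmod : zmod_closed star_idealb.
Proof.
split=> [|x y /asboolP Ix /asboolP Iy]; apply/asboolP.
  exact: star_ideal0 is_star_ideal_star_ideal.
exact: star_idealB is_star_ideal_star_ideal _ _ Ix Iy.
Qed.

HB.instance Definition _ := GRing.isZmodClosed.Build MA star_idealb
  star_idealb_zmod.

(* [alg] is only a [pzRingType] and an [lmodType]: the quotient may be zero,   *)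
(* so it has no canonical [algType] structure.                                *)
Definition alg : Type := @Quotient.quot MA star_idealb.
HB.instance Definition _ := GRing.Zmodule.on alg.
HB.instance Definition _ := EqQuotient.on alg.


Definition cls (x : MA) : alg := \pi_alg x.

Lemma cls_eq x y : cls x = cls y <-> star_ideal (x - y).
Proof.
split=> [/eqP|] xy.
  by apply/asboolP; change (x - y \in star_idealb); rewrite Quotient.idealrBE.
apply/eqP; change (x == y %[mod alg]); rewrite -Quotient.idealrBE.
exact/asboolP.
Qed.

Lemma cls_ind (P : alg -> Prop) : (forall x, P (cls x)) -> forall x, P x.
Proof. by move=> Ppi; elim/quotW. Qed.

Lemma cls_rel r : relations Q r -> cls r = 0.
Proof.
move=> Qr; have -> : 0 = cls 0 by rewrite /cls raddf0.
by apply/cls_eq; rewrite subr0; exact: sub_gen_smallest.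
Qed.

Lemma clsN x : cls (- x) = - cls x.
Proof. by rewrite /cls raddfN. Qed.

Lemma clsD x y : cls (x + y) = cls x + cls y.
Proof. by rewrite /cls raddfD. Qed.

Definition alg_one : alg := cls 1.
Definition alg_mul (x y : alg) : alg := cls (repr x * repr y).
Definition alg_scale (c : C) (x : alg) : alg := cls (c *: repr x).
Definition star (x : alg) : alg := cls (mstar (repr x)).

Fact repr_cls x : star_ideal (repr (cls x) - x).
Proof. by apply/cls_eq; rewrite /cls reprK. Qed.

Local Notation idealP := is_star_ideal_star_ideal.

Fact star_idealD x y : star_ideal x -> star_ideal y -> star_ideal (x + y).
Proof.
move=> Ix Iy; rewrite -[y]opprK; apply: (star_idealB idealP) => //.
by rewrite -[- y]sub0r; apply: (star_idealB idealP) => //; exact: star_ideal0 idealP.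
Qed.

Fact cls_mul x y : alg_mul (cls x) (cls y) = cls (x * y).
Proof.
apply/cls_eq.
have -> : repr (cls x) * repr (cls y) - x * y
    = (repr (cls x) - x) * repr (cls y) + x * (repr (cls y) - y).
  by rewrite mulrBl mulrBr addrA subrK.
apply: star_idealD.
  by apply: (star_idealMr idealP); exact: repr_cls.
by apply: (star_idealMl idealP); exact: repr_cls.
Qed.

Fact cls_scale c x : alg_scale c (cls x) = cls (c *: x).
Proof.
apply/cls_eq; rewrite -scalerBr -[_ - _]mul1r monalg_scaleAl.
by apply: (star_idealMl idealP); exact: repr_cls.
Qed.

Lemma star_cls x : star (cls x) = cls (mstar x).
Proof.
apply/cls_eq; rewrite -mstarB.
by apply: (star_idealS idealP); exact: repr_cls.
Qed.

Fact alg_mulA : associative alg_mul.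
Proof.
elim/cls_ind=> x; elim/cls_ind=> y; elim/cls_ind=> z.
by rewrite !cls_mul mulrA.
Qed.

Fact alg_mul1l : left_id alg_one alg_mul.
Proof. by elim/cls_ind=> x; rewrite cls_mul mul1r. Qed.

Fact alg_mul1r : right_id alg_one alg_mul.
Proof. by elim/cls_ind=> x; rewrite cls_mul mulr1. Qed.

Fact alg_mulDl : left_distributive alg_mul +%R.
Proof.
elim/cls_ind=> x; elim/cls_ind=> y; elim/cls_ind=> z.
by rewrite -clsD !cls_mul mulrDl clsD.
Qed.

Fact alg_mulDr : right_distributive alg_mul +%R.
Proof.
elim/cls_ind=> x; elim/cls_ind=> y; elim/cls_ind=> z.
by rewrite -clsD !cls_mul mulrDr clsD.
Qed.

HB.instance Definition _ :=
  GRing.Zmodule_isPzRing.Build alg alg_mulA alg_mul1l alg_mul1r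
    alg_mulDl alg_mulDr.

Fact alg_scaleA c d x : alg_scale c (alg_scale d x) = alg_scale (c * d) x.
Proof. by elim/cls_ind: x => x; rewrite !cls_scale scalerA. Qed.

Fact alg_scale1 : left_id 1 alg_scale.
Proof. by elim/cls_ind=> x; rewrite cls_scale scale1r. Qed.

Fact alg_scaleDr : right_distributive alg_scale +%R.
Proof.
move=> c; elim/cls_ind=> x; elim/cls_ind=> y.
by rewrite -clsD !cls_scale scalerDr clsD.
Qed.

Fact alg_scaleDl x : {morph alg_scale^~ x : c d / c + d}.
Proof. by elim/cls_ind: x => x c d; rewrite !cls_scale scalerDl clsD. Qed.

HB.instance Definition _ := GRing.Zmodule_isLmodule.Build C alg
  alg_scaleA alg_scale1 alg_scaleDr alg_scaleDl.

Lemma clsM x y : cls (x * y) = cls x * cls y.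
Proof. by rewrite -cls_mul. Qed.

Lemma cls1 : cls 1 = 1.
Proof. by []. Qed.

Lemma clsZ c x : cls (c *: x) = c *: cls x.
Proof. by rewrite -cls_scale. Qed.

Fact cls_linear : linear cls.
Proof. by move=> c x y; rewrite clsD clsZ. Qed.

Lemma algAl c (x y : alg) : c *: (x * y) = (c *: x) * y.
Proof.
elim/cls_ind: x => x; elim/cls_ind: y => y.
by rewrite -clsM -!clsZ -clsM monalg_scaleAl.
Qed.

Lemma algAr c (x y : alg) : c *: (x * y) = x * (c *: y).
Proof.
elim/cls_ind: x => x; elim/cls_ind: y => y.
by rewrite -clsM -!clsZ -clsM monalg_scaleAr.
Qed.

Lemma starK : involutive star.
Proof. by elim/cls_ind=> x; rewrite !star_cls mstarK. Qed.

Lemma starP c x y : star (c *: x + y) = c^* *: star x + star y.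
Proof.
elim/cls_ind: x => x; elim/cls_ind: y => y.
by rewrite -clsZ -clsD !star_cls mstarP clsD clsZ.
Qed.

Lemma star0 : star 0 = 0.
Proof.
have -> : 0 = cls 0 by rewrite /cls raddf0.
by rewrite star_cls mstar0.
Qed.

Lemma starD x y : star (x + y) = star x + star y.
Proof. by rewrite -[x]scale1r starP rmorph1 !scale1r. Qed.

Lemma star1 : star 1 = 1.
Proof. by rewrite -cls1 star_cls -mon1 mstar_mon invg1. Qed.

Lemma starM x y : star (x * y) = star y * star x.
Proof.
elim/cls_ind: x => x; elim/cls_ind: y => y.
by rewrite -clsM !star_cls mstarM clsM.
Qed.

Definition amon (m : M) : alg := cls (mon C m).

Lemma amonM m m' : amon (m * m')%g = amon m * amon m'.
Proof. by rewrite -clsM monM. Qed.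

Lemma amon1 : amon 1%g = 1.
Proof. by []. Qed.

Lemma star_amon m : star (amon m) = amon (m^-1)%g.
Proof. by rewrite star_cls mstar_mon. Qed.

Lemma alg_ind (P : alg -> Prop) :
  P 0 -> (forall c m x, P x -> P (c *: amon m + x)) -> forall x, P x.
Proof.
move=> P0 PD; elim/cls_ind; elim/monalg_ind => [|c m x IHx].
  by have -> : cls 0 = 0 by rewrite /cls raddf0.
by rewrite clsD clsZ; exact: PD.
Qed.

End PresentedAlgebra.

Definition star_closed (C : numClosedFieldType) (M : starMonoidType)
    (S : set (monalg C M)) :=
  forall r, S r -> S (mstar r) \/ S (- mstar r).

(* Linear maps out of a presented algebra: [f] is given on monomials, and its *)
(* linear extension has to vanish on [m * r * m'] for every relation [r].     *)
Section AlgLift.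
Context (C : numClosedFieldType) (Q : starpres C) (V : lmodType C).
Local Notation M := (monomials Q).
Context (f : M -> V) (Qstar : star_closed (relations Q)).
Hypothesis f_rel : forall r m m', relations Q r ->
  mlift f (mon C m * r * mon C m') = 0.

Fact mlift_ideal x : star_ideal x -> mlift f x = 0.
Proof.
pose I : set (monalg C M) := [set x | forall a b,
  mlift f (a * x * b) = 0 /\ mlift f (a * mstar x * b) = 0].
have f_relab r a b : relations Q r -> mlift f (a * r * b) = 0.
  move=> Qr; elim/monalg_ind: a => [|c m a IHa]; first by rewrite !mul0r linear0.
  rewrite !mulrDl -!monalg_scaleAl linearP IHa addr0.
  suff -> : mlift f (mon C m * r * b) = 0 by rewrite scaler0.
  elim/monalg_ind: b {IHa} => [|d m' b IHb]; first by rewrite mulr0 linear0.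
  by rewrite mulrDr -monalg_scaleAr linearP IHb addr0 f_rel ?scaler0.
move=> Ix; suff IP : I x by have [] := IP 1 1; rewrite mul1r mulr1.
move: x Ix; apply: smallest_sub; last first.
  move=> r Qr a b; split; first exact: f_relab.
  have [|Qr'] := Qstar Qr; first exact: f_relab.
  apply/eqP; rewrite -oppr_eq0 -linearN -mulNr -mulrN; apply/eqP.
  exact: f_relab.
split.
- by move=> a b; rewrite mstar0 mulr0 mul0r linear0.
- move=> y z Iy Iz a b; rewrite mstarB !mulrBr !mulrBl !linearB.
  by have [-> ->] := Iy a b; have [-> ->] := Iz a b; rewrite subr0.
- move=> y z Iz a b; rewrite mstarM !mulrA -(mulrA (a * mstar z)).
  by have [-> _] := Iz (a * y) b; have [_ ->] := Iz a (mstar y * b).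
- move=> y z Iz a b; rewrite mstarM !mulrA -(mulrA (a * z)).
  by have [-> _] := Iz a (y * b); have [_ ->] := Iz (a * mstar y) b.
- move=> y Iy a b; rewrite mstarK.
  by have [-> ->] := Iy a b.
Qed.

Fact mlift_repr x : mlift f (repr (cls x)) = mlift f x.
Proof.
apply/eqP; rewrite -subr_eq0 -linearB; apply/eqP.
by apply: mlift_ideal; exact: repr_cls.
Qed.

Fact alift_linear : linear (mlift f \o repr : alg Q -> V).
Proof.
move=> c; elim/cls_ind=> x; elim/cls_ind=> y.
change (mlift f (repr (c *: cls x + cls y))
  = c *: mlift f (repr (cls x)) + mlift f (repr (cls y))).
by rewrite -clsZ -clsD !mlift_repr linearP.
Qed.

Definition alift : {linear alg Q -> V} :=
  HB.pack (mlift f \o repr : alg Q -> V)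
    (GRing.isLinear.Build C (alg Q) V *:%R _ alift_linear).

Lemma alift_cls x : alift (cls x) = mlift f x.
Proof. exact: mlift_repr. Qed.

Lemma alift_amon m : alift (amon m) = f m.
Proof. by rewrite alift_cls mlift_mon. Qed.

End AlgLift.

(* The involution reverses words, i.e. the letters are self-adjoint.          *)
Section Words.
Context (G : choiceType).

Definition word := seq G.
HB.instance Definition _ := Choice.on word.

Fact word_revM : {morph (@rev G : word -> word) : u v / u ++ v >-> v ++ u}.
Proof. exact: rev_cat. Qed.

HB.instance Definition _ := isStarMonoid.Build word
  (@catA G) (@cat0s G) (@revK G) word_revM.

End Words.

Definition gen_pres (C : numClosedFieldType) (G : choiceType)
    (S : set (monalg C (word G))) : starpres C := StarPres S.

Definition gen (C : numClosedFieldType) (G : choiceType)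
    (S : set (monalg C (word G))) (x : G) : alg (gen_pres S) :=
  @amon C (gen_pres S) [:: x].

Section Hom.
Context (C : numClosedFieldType) (G : choiceType).
Context (S : set (monalg C (word G))) (B : starpres C) (g : G -> alg B).

Definition eval_word (w : word G) : alg B := \prod_(x <- w) g x.

Lemma eval_wordM u v : eval_word (u * v)%g = eval_word u * eval_word v.
Proof. exact: big_cat. Qed.

Lemma mlift_eval_wordM (x y : monalg C (word G)) :
  mlift eval_word (x * y) = mlift eval_word x * mlift eval_word y.
Proof.
elim/monalg_ind: x => [|c m x IHx]; first by rewrite !(mul0r, linear0).
rewrite mulrDl -monalg_scaleAl !linearP IHx mulrDl -algAl.
congr (_ *: _ + _); rewrite mlift_mon.
elim/monalg_ind: y {IHx} => [|d m' y IHy]; first by rewrite mulr0 !linear0 ?mulr0.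
rewrite mulrDr -monalg_scaleAr !linearP IHy mulrDr -algAr.
by rewrite monM !mlift_mon eval_wordM.
Qed.

Context (S_star : star_closed S).
Hypothesis g_rel : forall r, S r -> mlift eval_word r = 0.

Fact eval_word_rel r (m m' : word G) : S r ->
  mlift eval_word (mon C m * r * mon C m') = 0.
Proof. by move=> Sr; rewrite !mlift_eval_wordM (g_rel Sr) mulr0 mul0r. Qed.

Definition ahom : {linear alg (gen_pres S) -> alg B} :=
  @alift C (gen_pres S) (alg B) eval_word S_star eval_word_rel.

Lemma ahom_gen x : ahom (gen S x) = g x.
Proof. by rewrite /ahom alift_amon /eval_word big_seq1. Qed.

Lemma ahom1 : ahom 1 = 1.
Proof. by rewrite -amon1 /ahom alift_amon /eval_word big_nil. Qed.

Lemma ahomM x y : ahom (x * y) = ahom x * ahom y.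
Proof.
elim/cls_ind: x => x; elim/cls_ind: y => y.
by rewrite -clsM !alift_cls mlift_eval_wordM.
Qed.

Lemma ahom_star (g_star : forall x, star (g x) = g x) x :
  ahom (star x) = star (ahom x).
Proof.
elim/alg_ind: x => [|c m x IHx]; first by rewrite star0 !linear0 star0.
rewrite starP !linearP starP IHx star_amon /ahom !alift_amon.
congr (_ *: _ + _); elim: m {IHx} => [|a m IHm].
  by rewrite /eval_word !big_nil -[in RHS]amon1 star_amon invg1 //.
have -> : ((a :: m) : word G)^-1%g = ((m : word G)^-1 * [:: a])%g.
  by rewrite -[a :: m]/(([:: a] : word G) * m)%g invgM.
rewrite eval_wordM IHm {2}/eval_word big_seq1 {2}/eval_word big_cons.
by rewrite starM g_star.
Qed.

End Hom.

Section Tensor.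
Context (C : numClosedFieldType) (P Q : starpres C).

(* The algebraic tensor product is the monoid algebra of the pairs (a, b),    *)
(* with componentwise product and involution, modulo bilinearity.  The span   *)
(* of the bilinearity relations is already a *-ideal, so the underlying       *)
(* vector space is the usual tensor product (see [tlift]).                    *)
Definition etensor : Type := (alg P * alg Q)%type.
HB.instance Definition _ := Choice.on etensor.
Definition et_mul (x y : etensor) : etensor := (x.1 * y.1, x.2 * y.2).
Definition et_one : etensor := (1, 1).
Definition et_star (x : etensor) : etensor := (star x.1, star x.2).
Fact et_mulA : associative et_mul.
Proof. by move=> x y z; rewrite /et_mul /= !mulrA. Qed.
Fact et_mul1 : left_id et_one et_mul.
Proof. by case=> a b; rewrite /et_mul /= !mul1r. Qed.
Fact et_starK : involutive et_star.
Proof. by case=> a b; rewrite /et_star /= !starK. Qed.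
Fact et_starM : {morph et_star : x y / et_mul x y >-> et_mul y x}.
Proof. by move=> x y; rewrite /et_star /et_mul /= !starM. Qed.
HB.instance Definition _ := isStarMonoid.Build etensor
  et_mulA et_mul1 et_starK et_starM.

Definition emon (a : alg P) (b : alg Q) : monalg C etensor := mon C ((a, b) : etensor).

Definition bilinear_rel : set (monalg C etensor) :=
  [set r | (exists c a a' b,
              r = emon (c *: a + a') b - (c *: emon a b + emon a' b))
        \/ (exists c a b b',
              r = emon a (c *: b + b') - (c *: emon a b + emon a b'))].

Definition tensor_pres : starpres C := StarPres bilinear_rel.

Fact bilinear_rel_star : star_closed bilinear_rel.
Proof.
move=> r [[c [a [a' [b ->]]]]|[c [a [b [b' ->]]]]]; left; [left|right];
  rewrite mstarB mstarP !mstar_mon.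
- exists c^*, (star a), (star a'), (star b); congr (mon C _ - _).
  by rewrite -[LHS]/(et_star _) /et_star /= starP.
- exists c^*, (star a), (star b), (star b'); congr (mon C _ - _).
  by rewrite -[LHS]/(et_star _) /et_star /= starP.
Qed.

Definition tens (a : alg P) (b : alg Q) : alg tensor_pres :=
  @amon C tensor_pres ((a, b) : etensor).

Lemma tensPl c a a' b : tens (c *: a + a') b = c *: tens a b + tens a' b.
Proof.
apply/eqP; rewrite -subr_eq0 /tens /amon -clsZ -clsD -clsN -clsD; apply/eqP.
by apply: cls_rel; left; exists c, a, a', b.
Qed.

Lemma tensPr c a b b' : tens a (c *: b + b') = c *: tens a b + tens a b'.
Proof.
apply/eqP; rewrite -subr_eq0 /tens /amon -clsZ -clsD -clsN -clsD; apply/eqP.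
by apply: cls_rel; right; exists c, a, b, b'.
Qed.

Lemma tensM a b a' b' : tens a b * tens a' b' = tens (a * a') (b * b').
Proof. by rewrite /tens -amonM. Qed.

Lemma tens1 : tens 1 1 = 1.
Proof. exact: amon1. Qed.

Lemma star_tens a b : star (tens a b) = tens (star a) (star b).
Proof. exact: star_amon. Qed.

Section Lift.
Context (V : lmodType C) (f : alg P -> alg Q -> V).
Hypothesis fPl : forall c a a' b, f (c *: a + a') b = c *: f a b + f a' b.
Hypothesis fPr : forall c a b b', f a (c *: b + b') = c *: f a b + f a b'.

Fact tlift_rel r (m m' : etensor) : bilinear_rel r ->
  mlift (fun x : etensor => f x.1 x.2) (mon C m * r * mon C m') = 0.
Proof.
case: m m' => [a1 b1] [a2 b2].
case=> [[c [a [a' [b ->]]]]|[c [a [b [b' ->]]]]];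
  rewrite !(mulrBr, mulrBl, mulrDr, mulrDl) -monalg_scaleAr -monalg_scaleAl;
  rewrite !monM linearB linearP !mlift_mon /=;
  by rewrite mulrDr mulrDl -algAr -algAl (fPl, fPr) subrr.
Qed.

Definition tlift : {linear alg tensor_pres -> V} :=
  @alift C tensor_pres V (fun x : etensor => f x.1 x.2)
    bilinear_rel_star tlift_rel.

Lemma tlift_tens a b : tlift (tens a b) = f a b.
Proof. by rewrite /tlift alift_amon. Qed.

End Lift.
End Tensor.

Section TensorMaps.
Context (C : numClosedFieldType) (P Q P' Q' : starpres C).

Fact tens_mapPl (f : {linear alg P -> alg P'}) (g : {linear alg Q -> alg Q'})
    c a a' b :
  tens (f (c *: a + a')) (g b) = c *: tens (f a) (g b) + tens (f a') (g b).
Proof. by rewrite linearP tensPl. Qed.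

Fact tens_mapPr (f : {linear alg P -> alg P'}) (g : {linear alg Q -> alg Q'})
    c a b b' :
  tens (f a) (g (c *: b + b')) = c *: tens (f a) (g b) + tens (f a) (g b').
Proof. by rewrite linearP tensPr. Qed.

Definition tens_map (f : {linear alg P -> alg P'}) (g : {linear alg Q -> alg Q'})
    : {linear alg (tensor_pres P Q) -> alg (tensor_pres P' Q')} :=
  tlift (tens_mapPl f g) (tens_mapPr f g).

Fact tens_funPl (f : {linear alg P -> C^o}) (g : {linear alg Q -> C^o})
    c a a' b :
  f (c *: a + a') * g b = c *: (f a * g b : C^o) + f a' * g b :> C^o.
Proof. by rewrite linearP mulrDl -scalerAl. Qed.

Fact tens_funPr (f : {linear alg P -> C^o}) (g : {linear alg Q -> C^o})
    c a b b' :
  f a * g (c *: b + b') = c *: (f a * g b : C^o) + f a * g b' :> C^o.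
Proof. by rewrite linearP mulrDr -scalerAr. Qed.

Definition tens_fun (f : {linear alg P -> C^o}) (g : {linear alg Q -> C^o})
    : {linear alg (tensor_pres P Q) -> C^o} :=
  tlift (V := C^o) (tens_funPl f g) (tens_funPr f g).

End TensorMaps.

Lemma tens_map_id (C : numClosedFieldType) (P Q : starpres C) :
  tens_map (idfun : {linear alg P -> alg P}) (idfun : {linear alg Q -> alg Q})
    =1 idfun.
Proof.
elim/alg_ind => [|c [a b] y IHy]; first by rewrite linear0.
by rewrite linearP IHy /tens_map (tlift_tens _ _ a b).
Qed.

(* [tpow P n] presents the tensor power with [n.+1] factors. *)
Fixpoint tpow (C : numClosedFieldType) (P : starpres C) (n : nat) : starpres C :=
  if n is n'.+1 then tensor_pres P (tpow P n') else P.

Fixpoint tpow_fun (C : numClosedFieldType) (P : starpres C)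
    (f : {linear alg P -> C^o}) (n : nat) : {linear alg (tpow P n) -> C^o} :=
  if n is n'.+1 then tens_fun f (tpow_fun f n') else f.

Definition letter (C : numClosedFieldType) (G : choiceType) (x : G) :
  monalg C (word G) := mon C ([:: x] : word G).

Section HomLetters.
Context (C : numClosedFieldType) (G : choiceType) (B : starpres C).
Context (g : G -> alg B).

Lemma mlift_eval_letter x : mlift (eval_word g) (letter C x) = g x.
Proof. by rewrite mlift_mon /eval_word big_seq1. Qed.

Lemma mlift_eval_one : mlift (eval_word g) 1 = 1.
Proof. by rewrite -mon1 mlift_mon /eval_word big_nil. Qed.

Definition mlift_evalE :=
  (mlift_eval_wordM, mlift_eval_letter, mlift_eval_one).

End HomLetters.

Lemma mstar_letter (C : numClosedFieldType) (G : choiceType) (x : G) :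
  mstar (letter C x) = letter C x.
Proof. exact: mstar_mon. Qed.

Lemma mstar1 (C : numClosedFieldType) (M : starMonoidType) :
  mstar (1 : monalg C M) = 1.
Proof. by rewrite -mon1 mstar_mon invg1. Qed.

Inductive bletter := LY | LP.

Definition bletter_bool (x : bletter) := if x is LY then true else false.
Definition bool_bletter (b : bool) := if b then LY else LP.
Fact bletter_boolK : cancel bletter_bool bool_bletter. Proof. by case. Qed.
HB.instance Definition _ := Choice.copy bletter (can_type bletter_boolK).

Section BooleanExtension.
Context (C : numClosedFieldType).

Definition YP_rel : set (monalg C (word bletter)) :=
  [set letter C LP * letter C LP - letter C LP].

Definition YP := gen_pres YP_rel.
Definition Yb : alg YP := gen YP_rel LY.
Definition Pb : alg YP := gen YP_rel LP.

Fact YP_rel_star : star_closed YP_rel.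
Proof. by move=> _ ->; left; rewrite mstarB mstarM !mstar_letter. Qed.

Lemma PbPb : Pb * Pb = Pb.
Proof.
apply/eqP; rewrite -subr_eq0 /Pb /gen -amonM /amon -clsN -clsD -monM.
by apply/eqP/cls_rel.
Qed.

Lemma star_Pb : star Pb = Pb.
Proof. exact: star_amon. Qed.

Context (phi : {linear {poly C} -> C^o}).

Definition moment (r : nat) : C := if r is 0 then 1 else phi 'X^r.

(* Product of the moments of the maximal runs of Y in the word Y^r w.         *)
Fixpoint runs (r : nat) (w : seq bletter) : C :=
  match w with
  | [::] => moment r
  | LY :: w' => runs r.+1 w'
  | LP :: w' => moment r * runs 0 w'
  end.

Fact runs_PP r u v : runs r (u ++ [:: LP, LP & v]) = runs r (u ++ LP :: v).
Proof.
elim: u r => [|[] u IHu] r /=; first by rewrite mul1r.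
  exact: IHu.
by rewrite IHu.
Qed.

Fact runs_rel r (m m' : word bletter) : YP_rel r ->
  mlift (runs 0 : word bletter -> C^o) (mon C m * r * mon C m') = 0.
Proof.
move=> ->; rewrite mulrBr mulrBl linearB !monM !mlift_mon.
rewrite -[X in runs _ X](catA m [:: LP; LP] m') -[X in _ - runs _ X](catA m [:: LP] m').
by rewrite runs_PP subrr.
Qed.

Definition boolean_ext : {linear alg YP -> C^o} :=
  @alift C YP C^o (runs 0) YP_rel_star runs_rel.

Lemma boolean_ext1 : boolean_ext 1 = 1.
Proof. by rewrite -amon1 /boolean_ext alift_amon. Qed.

Lemma boolean_extP : boolean_ext Pb = 1.
Proof. by rewrite /boolean_ext alift_amon /= mulr1. Qed.

Lemma boolean_ext_word (a b : bool) n (s : seq nat) :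
  (0 < n)%N -> all (leq 1) s ->
  boolean_ext (Pb ^+ a * (Yb ^+ n * \prod_(k <- s) (Pb * Yb ^+ k)) * Pb ^+ b)
  = phi 'X^n * \prod_(k <- s) phi 'X^k.
Proof.
move=> n_gt0 s_gt0.
have amonX x k : gen YP_rel x ^+ k = @amon C YP (nseq k x).
  elim: k => [|k IHk]; first by rewrite expr0 -amon1.
  by rewrite exprS IHk -amonM.
have -> : \prod_(k <- s) (Pb * Yb ^+ k)
    = @amon C YP (flatten [seq LP :: nseq k LY | k <- s]).
  elim: s {s_gt0} => [|k s IHs]; first by rewrite big_nil -amon1.
  by rewrite big_cons IHs amonX -!amonM.
have -> : forall u, Pb ^+ a * (Yb ^+ n * @amon C YP u) * Pb ^+ b
    = @amon C YP (nseq a LP ++ nseq n LY ++ u ++ nseq b LP).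
  move=> u; rewrite /Pb /Yb !amonX -!amonM; congr (@amon C YP _).
  by rewrite -[LHS]/((nseq a LP ++ (nseq n LY ++ u)) ++ nseq b LP) -!catA.
have runsY r k w : runs r (nseq k LY ++ w) = runs (r + k) w.
  by elim: k r => [|k IHk] r /=; rewrite ?addn0 // IHk addSnnS.
rewrite /boolean_ext alift_amon.
have -> : forall w, runs 0 (nseq a LP ++ nseq n LY ++ w) = runs n w.
  by move=> w; case: a; rewrite /= ?mul1r runsY.
elim: s n n_gt0 s_gt0 => [|k s IHs] [//|n] _ /=.
  by rewrite big_nil; case: b => //=; rewrite mulr1.
by case: k => [//|k] /= s_gt0; rewrite -catA runsY big_cons IHs.
Qed.

End BooleanExtension.

Section InfiniteTensor.
Context (C : numClosedFieldType).
Local Notation A := (alg (YP C)).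

Definition is_tail (a : A) : Prop := a = 1 \/ a = Pb C.

Fact is_tailM a b : is_tail a -> is_tail b -> is_tail (a * b).
Proof.
by move=> [->|->] [->|->]; rewrite ?mul1r ?mulr1 ?PbPb;
  [left|right|right|right].
Qed.

Fact is_tail_star a : is_tail a -> is_tail (star a).
Proof.
by move=> [->|->]; [left; rewrite -amon1 star_amon invg1|right; rewrite star_Pb].
Qed.

Definition itensor : Type :=
  {z : nat -> A | `[< finite_set [set k | ~ is_tail (z k)] >]}.
HB.instance Definition _ := Choice.on itensor.

Fact it_mul_subproof (x y : itensor) :
  `[< finite_set [set k | ~ is_tail (val x k * val y k)] >].
Proof.
apply/asboolP; move: (asboolW (valP x)) (asboolW (valP y)) => fx fy.
apply: (@sub_finite_set _ _ ([set k | ~ is_tail (val x k)]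
    `|` [set k | ~ is_tail (val y k)])); last by rewrite finite_setU.
move=> k /= xyk; have [xk|] := pselect (is_tail (val x k)); last by left.
by right=> yk; apply: xyk; exact: is_tailM.
Qed.

Definition it_mul (x y : itensor) : itensor :=
  exist _ (fun k => val x k * val y k) (it_mul_subproof x y).

Fact it_one_subproof : `[< finite_set [set k : nat | ~ is_tail 1] >].
Proof.
apply/asboolP; have -> : [set _ : nat | ~ is_tail 1] = set0.
  by apply/seteqP; split=> // k /=; apply; left.
exact: finite_set0.
Qed.

Definition it_one : itensor := exist _ (fun=> 1) it_one_subproof.

Fact it_star_subproof (x : itensor) :
  `[< finite_set [set k | ~ is_tail (star (val x k))] >].
Proof.
apply/asboolP; apply: sub_finite_set (asboolW (valP x)) => k /= xk.
by move=> /is_tail_star.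
Qed.

Definition it_star (x : itensor) : itensor :=
  exist _ (fun k => star (val x k)) (it_star_subproof x).

Lemma itensor_eq (x y : itensor) : val x =1 val y -> x = y.
Proof. by move=> xy; apply: val_inj; apply: funext. Qed.

Fact it_mulA : associative it_mul.
Proof. by move=> x y z; apply: itensor_eq => k /=; rewrite mulrA. Qed.
Fact it_mul1 : left_id it_one it_mul.
Proof. by move=> x; apply: itensor_eq => k /=; rewrite mul1r. Qed.
Fact it_starK : involutive it_star.
Proof. by move=> x; apply: itensor_eq => k /=; rewrite starK. Qed.
Fact it_starM : {morph it_star : x y / it_mul x y >-> it_mul y x}.
Proof. by move=> x y; apply: itensor_eq => k /=; rewrite starM. Qed.
HB.instance Definition _ := isStarMonoid.Build itensor
  it_mulA it_mul1 it_starK it_starM.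

(* [z], [x], [y] agree off the site [j], and [z j = c *: x j + y j]. *)
Definition site_linear (j : nat) (c : C) (x y z : itensor) : Prop :=
  val z j = c *: val x j + val y j /\
  (forall k, k != j -> val x k = val z k /\ val y k = val z k).

Definition multilinear_rel : set (monalg C itensor) :=
  [set r | exists j c x y z, site_linear j c x y z
     /\ r = mon C z - (c *: mon C x + mon C y)].

Definition infinite_tensor_pres : starpres C := StarPres multilinear_rel.

Definition itens (z : itensor) : alg infinite_tensor_pres :=
  @amon C infinite_tensor_pres z.

Fact multilinear_rel_star : star_closed multilinear_rel.
Proof.
move=> _ [j [c [x [y [z [[zj zk] ->]]]]]]; left.
rewrite mstarB mstarP !mstar_mon.
exists j, c^*, (it_star x), (it_star y), (it_star z); split=> //; split=> /=.
  by rewrite zj starP.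
by move=> k /zk[-> ->].
Qed.

Fact site_linearM j c x y z u v : site_linear j c x y z ->
  site_linear j c (u * x * v)%g (u * y * v)%g (u * z * v)%g.
Proof.
move=> [zj zk]; split=> /=; first by rewrite zj mulrDr mulrDl -algAr -algAl.
by move=> k /zk[-> ->].
Qed.

Section Functional.
Context (psi : {linear A -> C^o}) (psi1 : psi 1 = 1) (psiP : psi (Pb C) = 1).

Definition it_fun (z : itensor) : C :=
  \big[*%R/1]_(k \in [set: nat]) (psi (val z k) : C).

Fact it_funE j z :
  it_fun z = psi (val z j) * \big[*%R/1]_(k \in ~` [set j]) (psi (val z k) : C).
Proof.
pose D := [set k | ~ is_tail (val z k)] `|` [set j].
have finD : finite_set D.
  by rewrite finite_setU; split; [exact: asboolW (valP z)|exact: finite_set1].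
have psiD k : ~ D k -> psi (val z k) = 1.
  move=> /not_orP[/contrapT[->|->] _]; [exact: psi1|exact: psiP].
rewrite /it_fun -(fsbig_widen D) //; last by move=> k [_ /psiD].
rewrite (fsbigD1 j) //=; last by right.
congr (_ * _); apply: fsbig_widen; first by move=> k [_ kj].
by move=> k [kj /= Dk]; apply: psiD => Dk'; apply: Dk; split.
Qed.

Fact it_fun_rel r (u v : itensor) : multilinear_rel r ->
  mlift (it_fun : itensor -> C^o) (mon C u * r * mon C v) = 0.
Proof.
move=> [j [c [x [y [z [zxy ->]]]]]].
rewrite mulrBr mulrBl mulrDr mulrDl -monalg_scaleAr -monalg_scaleAl !monM.
rewrite linearB linearP !mlift_mon.
have [zj zk] := site_linearM u v zxy; rewrite !(it_funE j) zj linearP.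
pose rest (w : itensor) := \big[*%R/1]_(k \in ~` [set j]) (psi (val w k) : C).
have restx : rest (u * x * v)%g = rest (u * z * v)%g.
  by apply: eq_fsbigr => k; rewrite inE => /eqP/zk[-> _].
have resty : rest (u * y * v)%g = rest (u * z * v)%g.
  by apply: eq_fsbigr => k; rewrite inE => /eqP/zk[_ ->].
rewrite -!/(rest _) restx resty.
by rewrite mulrDl -scalerAl subrr.
Qed.

Definition infinite_tensor_fun : {linear alg infinite_tensor_pres -> C^o} :=
  @alift C infinite_tensor_pres C^o it_fun multilinear_rel_star it_fun_rel.

Lemma infinite_tensor_fun_itens z : infinite_tensor_fun (itens z) = it_fun z.
Proof. by rewrite /infinite_tensor_fun alift_amon. Qed.

End Functional.
End InfiniteTensor.

(* The index set of the sites is [nat], starting at 0; only its being a        *)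
(* countably infinite set matters.                                            *)
Inductive hletter := LX of nat & set nat | LPs of set nat.

Definition hletter_sum (x : hletter) : nat * set nat + set nat :=
  match x with LX k s => inl (k, s) | LPs s => inr s end.
Definition sum_hletter (x : nat * set nat + set nat) : hletter :=
  match x with inl (k, s) => LX k s | inr s => LPs s end.
Fact hletter_sumK : cancel hletter_sum sum_hletter. Proof. by case. Qed.
HB.instance Definition _ := Choice.copy hletter (can_type hletter_sumK).

Section Bhat.
Context (C : numClosedFieldType).
Local Notation lX k s := (letter C (LX k s)).
Local Notation lP s := (letter C (LPs s)).

Definition Bhat_rel : set (monalg C (word hletter)) :=
  [set r | (exists s t, r = lP s * lP t - lP (s `&` t))
        \/ r = lP setT - 1
        \/ (exists k s t, s k /\ r = lP s * lX k t - lX k t * lP s)].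

Definition Bhat := gen_pres Bhat_rel.
Definition Xhat k s : alg Bhat := gen Bhat_rel (LX k s).
Definition Phat s : alg Bhat := gen Bhat_rel (LPs s).

Fact Bhat_rel_star : star_closed Bhat_rel.
Proof.
move=> _ [[s [t ->]]|[->|[k [s [t [sk ->]]]]]].
- left; left; exists t, s.
  by rewrite mstarB mstarM !mstar_letter setIC.
- by left; right; left; rewrite mstarB mstar_letter mstar1.
- right; right; right; exists k, s, t; split=> //.
  by rewrite mstarB !mstarM !mstar_letter opprB.
Qed.

Lemma PhatM s t : Phat s * Phat t = Phat (s `&` t).
Proof.
apply/eqP; rewrite -subr_eq0 /Phat /gen -amonM /amon -clsN -clsD -monM.
by apply/eqP/cls_rel; left; exists s, t.
Qed.

Lemma PhatT : Phat setT = 1.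
Proof.
apply/eqP; rewrite -subr_eq0 /Phat /gen -cls1 /amon -clsN -clsD.
by apply/eqP/cls_rel; right; left.
Qed.

Lemma Phat_Xhat k s t : s k -> Phat s * Xhat k t = Xhat k t * Phat s.
Proof.
move=> sk; apply/eqP; rewrite -subr_eq0 /Phat /Xhat /gen -!amonM /amon -clsN -clsD -!monM.
by apply/eqP/cls_rel; right; right; exists k, s, t.
Qed.

Definition coproduct_gen (x : hletter) : alg (tensor_pres Bhat Bhat) :=
  match x with
  | LX k s => tens (Xhat k s) (Phat s) + tens (Phat s) (Xhat k s)
  | LPs s => tens (Phat s) (Phat s)
  end.

Fact coproduct_rel r : Bhat_rel r -> mlift (eval_word coproduct_gen) r = 0.
Proof.
move=> [[s [t ->]]|[->|[k [s [t [sk ->]]]]]].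
- by rewrite linearB !mlift_evalE /= tensM !PhatM subrr.
- by rewrite linearB !mlift_evalE /= PhatT tens1 subrr.
- rewrite linearB !mlift_evalE /= mulrDl mulrDr !tensM !PhatM !(Phat_Xhat _ sk).
  by rewrite setIC subrr.
Qed.

Definition coproduct : {linear alg Bhat -> alg (tensor_pres Bhat Bhat)} :=
  ahom Bhat_rel_star coproduct_rel.

Fixpoint coproduct_iter (n : nat) : {linear alg Bhat -> alg (tpow Bhat n)} :=
  if n is n'.+1
  then (tens_map idfun (coproduct_iter n') \o coproduct)%FUN
  else idfun.

Lemma coproductX k s : coproduct (Xhat k s) = tens (Xhat k s) (Phat s) + tens (Phat s) (Xhat k s).
Proof. exact: ahom_gen. Qed.

Lemma coproductP s : coproduct (Phat s) = tens (Phat s) (Phat s).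
Proof. exact: ahom_gen. Qed.

Lemma coproduct1 : coproduct 1 = 1.
Proof. exact: ahom1. Qed.

Lemma coproductM x y : coproduct (x * y) = coproduct x * coproduct y.
Proof. exact: ahomM. Qed.

Lemma coproduct_star x : coproduct (star x) = star (coproduct x).
Proof.
apply: ahom_star => -[k s|s] /=; last by rewrite star_tens star_amon.
by rewrite starD !star_tens !star_amon.
Qed.

Lemma coproduct_iter1 : coproduct_iter 1 =1 coproduct.
Proof.
by move=> x; exact: tens_map_id (coproduct x).
Qed.

(* The N-th convolution power for N >= 1; the value at N = 0 is junk. *)
Definition conv_pow (phi : {linear alg Bhat -> C^o}) (N : nat) :
    {linear alg Bhat -> C^o} :=
  (tpow_fun phi N.-1 \o coproduct_iter N.-1)%FUN.

Definition site_fun (k : nat) (a : alg (YP C)) (j : nat) : alg (YP C) :=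
  if j == k then a else 1.

Definition off_site (s : set nat) (j : nat) : alg (YP C) :=
  if j \in s then 1 else Pb C.

Fact site_subproof k a :
  `[< finite_set [set j | ~ is_tail (site_fun k a j)] >].
Proof.
apply/asboolP; apply: (@sub_finite_set _ _ [set k]); last exact: finite_set1.
move=> j /=; rewrite /site_fun; case: eqP => // _ H; exfalso; apply: H.
by left.
Qed.

Fact off_site_subproof s :
  `[< finite_set [set j | ~ is_tail (off_site s j)] >].
Proof.
apply/asboolP; have -> : [set j | ~ is_tail (off_site s j)] = set0.
  apply/seteqP; split=> // j /=; rewrite /off_site; case: ifP => _ H; apply: H.
    by left.
  by right.
exact: finite_set0.
Qed.

Definition eta_gen (x : hletter) : alg (infinite_tensor_pres C) :=
  match x with
  | LX k s => itens (exist _ (site_fun k (Yb C)) (site_subproof k (Yb C)))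
  | LPs s => itens (exist _ (off_site s) (off_site_subproof s))
  end.

Fact eta_rel r : Bhat_rel r -> mlift (eval_word eta_gen) r = 0.
Proof.
move=> [[s [t ->]]|[->|[k [s [t [sk ->]]]]]].
- rewrite linearB !mlift_evalE /= /itens -amonM; apply/eqP; rewrite subr_eq0.
  apply/eqP; congr amon; apply: itensor_eq => j /=; rewrite /off_site in_setI.
  by do 2![case: (_ \in _)]; rewrite /= ?mul1r ?mulr1 ?PbPb.
- rewrite linearB !mlift_evalE /= -amon1 /itens; apply/eqP; rewrite subr_eq0.
  by apply/eqP; congr amon; apply: itensor_eq => j /=; rewrite /off_site in_setT.
- rewrite linearB !mlift_evalE /= /itens -!amonM; apply/eqP; rewrite subr_eq0.
  apply/eqP; congr amon; apply: itensor_eq => j /=; rewrite /off_site /site_fun.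
  by case: eqP => [->|_]; rewrite ?mul1r ?mulr1 // mem_set // mul1r mulr1.
Qed.

Definition hat_eta : {linear alg Bhat -> alg (infinite_tensor_pres C)} :=
  ahom Bhat_rel_star eta_rel.

Lemma etaX k s :
  hat_eta (Xhat k s) = itens (exist _ (site_fun k (Yb C)) (site_subproof k (Yb C))).
Proof. exact: ahom_gen. Qed.

Lemma etaP s : hat_eta (Phat s) = itens (exist _ (off_site s) (off_site_subproof s)).
Proof. exact: ahom_gen. Qed.

Lemma eta1 : hat_eta 1 = 1.
Proof. exact: ahom1. Qed.

Lemma etaM x y : hat_eta (x * y) = hat_eta x * hat_eta y.
Proof. exact: ahomM. Qed.

Lemma eta_star x : hat_eta (star x) = star (hat_eta x).
Proof.
apply: ahom_star => -[k s|s]; rewrite /= star_amon; congr (@amon C (infinite_tensor_pres C) _);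
  apply: itensor_eq => j /=.
  by rewrite /site_fun; case: eqP => _; rewrite ?star1 // star_amon.
by rewrite /off_site; case: ifP => _; rewrite ?star1 // star_Pb.
Qed.

Definition hat_state (phi : {linear {poly C} -> C^o}) :
    {linear alg Bhat -> C^o} :=
  (infinite_tensor_fun (boolean_ext1 phi) (boolean_extP phi) \o hat_eta)%FUN.


Lemma hat_stateX phi k s : hat_state phi (Xhat k s) = phi 'X.
Proof.
change (infinite_tensor_fun (boolean_ext1 phi) (boolean_extP phi)
  (hat_eta (Xhat k s)) = phi 'X).
rewrite etaX infinite_tensor_fun_itens.
rewrite (it_funE (boolean_ext1 phi) (boolean_extP phi) k).
rewrite fsbig1 ?mulr1; last first.
  move=> j jk; rewrite -[val _ j]/(site_fun k (Yb C) j) /site_fun.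
  by case: eqP => [/jk|_]; last exact: boolean_ext1.
rewrite -[val _ k]/(site_fun k (Yb C) k) /site_fun eqxx.
by rewrite /boolean_ext /Yb /gen alift_amon.
Qed.

Definition degree (w : word hletter) : nat :=
  count (fun x => if x is LX _ _ then true else false) w.

Definition dilation_word (N : nat) (w : word hletter) : alg Bhat :=
  sqrtC (N%:R : C) ^- degree w *: @amon C Bhat w.

Fact dilation_rel N r (m m' : word hletter) : Bhat_rel r ->
  mlift (dilation_word N) (mon C m * r * mon C m') = 0.
Proof.
have key u v : degree u = degree v -> Bhat_rel (mon C u - mon C v) ->
    mlift (dilation_word N) (mon C m * (mon C u - mon C v) * mon C m') = 0.
  move=> uv Buv; rewrite mulrBr mulrBl linearB !monM !mlift_mon /dilation_word.
  have -> : degree (m * v * m')%g = degree (m * u * m')%g.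
    by rewrite /degree !count_cat -!/(degree _) uv.
  rewrite -scalerBr; suff -> : @amon C Bhat (m * u * m')%g
    - @amon C Bhat (m * v * m')%g = 0 by rewrite scaler0.
  have /= B0 := @cls_rel C Bhat _ Buv.
  rewrite !(@amonM C Bhat).
  by rewrite -mulrBl -mulrBr /amon -clsN -clsD B0 mulr0 mul0r.
move=> Br; case: (Br) => [[s [t E]]|[E|[k [s [t [sk E]]]]]]; move: Br; rewrite E.
- by rewrite monM; exact: key.
- by rewrite -mon1; exact: key.
- by rewrite !monM; exact: key.
Qed.

Definition dilation (N : nat) : {linear alg Bhat -> alg Bhat} :=
  @alift C Bhat (alg Bhat) (dilation_word N) Bhat_rel_star (@dilation_rel N).

Lemma dilation_amon N (w : word hletter) :
  dilation N (@amon C Bhat w) = sqrtC (N%:R : C) ^- degree w *: @amon C Bhat w.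
Proof. exact: alift_amon. Qed.

End Bhat.

Arguments Xhat {C} k s.
Arguments Phat {C} s.
Arguments dilation {C} N.

Section Partitions.
Context (n : nat) (k : 'I_n -> nat) (s : 'I_n -> set nat).

Definition adapted (R : {set {set 'I_n}}) : bool :=
  [forall B in R, forall i in B, forall j in B, k i == k j] &&
  [forall B in R, forall i in B, forall j in B, forall m : 'I_n,
     [&& i < m, m < j & m \notin B]%N ==> (k i == k j) && (k j \in s m)].

Definition adapted_pair_partitions : {set {set {set 'I_n}}} :=
  [set R : {set {set 'I_n}} | [&& finset.partition R [set: 'I_n], adapted R
     & [forall B in R, #|B| == 2%N]]]%SET.

End Partitions.

(* On C[Y] with Y self-adjoint, the involution conjugates the coefficients.   *)
Definition poly_state (C : numClosedFieldType) (phi : {linear {poly C} -> C^o}) :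
    Prop :=
  phi 1 = 1 /\ forall p : {poly C}, 0 <= (phi (map_poly Num.conj p * p) : C).

Definition Cplx (R : realType) : numClosedFieldType := R[i].

(* Main.v *)
Require Import Defs.
From mathcomp Require Import all_boot all_order all_algebra.
From mathcomp Require Import all_classical all_reals.
From mathcomp Require Import topology normedtype sequences complex.

Import Order.TTheory GRing.Theory Num.Theory.
Import numFieldNormedType.Exports.
Local Open Scope classical_set_scope.
Local Open Scope ring_scope.

(** Mark a subset [B] of the letters of the word: let W(B) be the product in
    which the letters in [B] are X_{k_m}(sigma_m) and the others P(sigma_m), and
    let M(B) be the value of the state on W(B).  Expanding the coproduct of each
    factor shows that W(B) is mapped to the sum over A included in B of
    W(A) (x) W(B \ A) ([coproduct_marked_word]).  Hence the N-th convolution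
    power of the state is, on marked words, the N-th power of the set function M
    for the subset convolution ([conv_pow_marked_word]).

    As M(empty) = 1, that power is an exponential formula: at B it is the sum
    over the partitions P of B of N(N-1)...(N-|P|+1) times the product of M over
    the blocks of P ([subset_conv_powE]); the falling factorial counts the
    distinct tensor legs that the blocks of P may occupy.

    After division by N^(n/2), a partition with fewer than n/2 blocks contributes
    0 in the limit, one with a singleton block contributes 0 already for finite N
    because the variables are centred, and one without singletons has at most n/2
    blocks, with equality exactly for pairings.  So the limit is the sum over
    pairings of the product of M over their blocks ([subset_conv_pow_clt]).

    Finally M({i, j}) is computed site by site in the infinite tensor product.
    Sites carrying only units and projections give 1.  If k_i differs from k_j,
    the site k_i carries a single Y and gives the mean 0.  If k_i = k_j, that
    site carries Y..Y, and a projection separates the two Y, splitting the second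
    moment 1 into the product 0 of two means, exactly when some m strictly
    between i and j has k_j outside sigma_m ([hat_state_pair]).  Thus
    M({i, j}) is 1 or 0 according to whether the block is adapted, and the limit
    counts the adapted pairings.  There are none when n is odd. *)

(** * Powers for the subset convolution *)

Section SubsetConvolution.
Context (K : comPzRingType) (T : finType) (M : {set T} -> K).
Implicit Types (A B : {set T}) (R : {set {set T}}).

Fixpoint subset_conv_pow (N : nat) (B : {set T}) : K :=
  if N is N'.+1
  then \sum_(A : {set T} | A \subset B) M A * subset_conv_pow N' (B :\: A)%SET
  else (B == finset.set0)%:R.

Lemma subset_conv_powS N B : subset_conv_pow N.+1 B =
  \sum_(A : {set T} | A \subset B) M A * subset_conv_pow N (B :\: A)%SET.
Proof. by []. Qed.

Lemma subset_conv_pow1 B : subset_conv_pow 1 B = M B.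
Proof.
rewrite /= (bigD1 B) //= finset.setDv eqxx mulr1 big1 ?addr0 // => A /andP[AB nAB].
rewrite finset.setD_eq0; suff -> : (B \subset A) = false by rewrite mulr0.
by apply: contraNF nAB => BA; rewrite finset.eqEsubset AB BA.
Qed.

Lemma ffactS_addn N p : (N.+1 ^_ p = N ^_ p + p * N ^_ p.-1)%N.
Proof.
case: p => [|p]; first by rewrite !ffactn0.
rewrite ffactSS ffactnSr /=.
have [pN|Np] := leqP p N; last by rewrite ffact_small // !(muln0, mul0n).
by rewrite (mulnC p.+1) -mulnDr addnS subnK // mulnC.
Qed.

Context (M0 : M finset.set0 = 1).

(** By induction on [N].  In the convolution of [M] with the [N]-th power, the
    term of the empty set reproduces the [N]-th power, while choosing a nonempty
    [A] and a partition of the rest amounts to choosing a partition together with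
    one of its blocks.  This is the recursion
    [N.+1 ^_ p = N ^_ p + p * N ^_ p.-1]. *)
Lemma subset_conv_powE N B : subset_conv_pow N B =
  \sum_(R | finset.partition R B) (N ^_ #|R|)%:R * \prod_(A in R) M A.
Proof.
elim: N B => [|N IHN] B.
  have part0 : finset.partition finset.set0 B = (B == finset.set0).
    by rewrite /finset.partition /finset.trivIset /finset.cover !big_set0 cards0
      !finset.inE eqxx eq_sym !andbT.
  rewrite /= (bigID (pred1 finset.set0)) /= [X in _ = _ + X]big1 ?addr0; last first.
    by move=> R /andP[_ R0]; rewrite ffact0n cards_eq0 (negPf R0) mul0r.
  rewrite (eq_bigl (fun R => (R == finset.set0) && (B == finset.set0))); last first.
    by move=> R /=; case: eqP => [->|_]; rewrite ?part0 ?andbT ?andbF.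
  case: (B == finset.set0); last by rewrite big_pred0 // => R; rewrite andbF.
  under eq_bigl do rewrite andbT.
  by rewrite big_pred1_eq cards0 big_set0 mulr1.
rewrite /= (bigD1 finset.set0) ?finset.sub0set //= M0 mul1r finset.setD0 IHN.
transitivity (\sum_(R | finset.partition R B) ((N ^_ #|R|)%:R * \prod_(A in R) M A)
  + \sum_(R | finset.partition R B)
      \sum_(A in R) (N ^_ #|R|.-1)%:R * \prod_(A' in R) M A').
  congr (_ + _).
  rewrite (exchange_big_dep (fun A => (A \subset B) && (A != finset.set0))) /=; last first.
    by move=> R A RB AR; rewrite (finset.partitionS RB AR) (finset.partition_neq0 RB AR).
  apply: eq_bigr => A /andP[AB A0].
  rewrite IHN big_distrr /=.
  have notinA R : finset.partition R (B :\: A)%SET -> A \notin R.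
    move=> RBA; apply: contra A0 => /(finset.partitionS RBA).
    by rewrite finset.subsetD => /andP[_]; rewrite -finset.setI_eq0 finset.setIid.
  (* For fixed [A], adding and removing the block [A] are inverse bijections. *)
  rewrite [RHS](reindex_onto (fun R => A |: R)%SET (fun R => R :\ A)%SET) /=; last first.
    by move=> R /andP[_ AR]; rewrite finset.setD1K.
  apply: eq_big => [R|R RBA]; last first.
    rewrite finset.big_setU1 ?notinA //= finset.cardsU1 (notinA _ RBA) add1n /=.
    by rewrite mulrCA.
  apply/idP/idP => [RBA|/andP[/andP[RB AR] /eqP <-]]; last exact: finset.partitionD1.
  rewrite finset.setU11 finset.setU1K ?notinA // eqxx !andbT.
  have := finset.partitionU1 RBA A0; rewrite finset.setDE finset.setUIr finset.setUCr finset.setIT.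
  rewrite (finset.setUidPr AB); apply.
  by rewrite finset.disjoints_subset finset.setCI finset.setCK finset.subsetUr.
rewrite -big_split; apply: eq_bigr => R RB /=.
by rewrite sumr_const ffactS_addn natrD mulrDl natrM -mulrA [#|R|%:R * _]mulr_natl.
Qed.
End SubsetConvolution.

Arguments subset_conv_pow {K T} M N B.

(** * The coproduct on marked words *)

Lemma prodr_zero_factor (A : pzRingType) (T : eqType) (r : seq T) (F : T -> A) t :
  t \in r -> F t = 0 -> \prod_(m <- r) F m = 0.
Proof.
by move=> /(path.splitPr)[r1 r2] Ft; rewrite big_cat big_cons /= Ft mul0r mulr0.
Qed.

Lemma prod_tens (C : numClosedFieldType) (P Q : starpres C) (T : Type) (r : seq T)
    (a : T -> alg P) (b : T -> alg Q) :
  \prod_(m <- r) tens (a m) (b m) = tens (\prod_(m <- r) a m) (\prod_(m <- r) b m).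
Proof.
elim: r => [|m r IHr]; first by rewrite !big_nil tens1.
by rewrite !big_cons IHr tensM.
Qed.

Section MarkedWords.
Context (C : numClosedFieldType) (T : finType) (k : T -> nat) (s : T -> set nat).
Implicit Types A B : {set T}.

Definition marked_letter (B : {set T}) (m : T) : alg (Bhat C) :=
  if m \in B then Xhat (k m) (s m) else Phat (s m).

Definition marked_word (B : {set T}) : alg (Bhat C) := \prod_m marked_letter B m.

(** Each marked letter contributes X (x) P + P (x) X and each unmarked one
    P (x) P, so distributing the product amounts to choosing the set [A] of the
    marked letters whose X goes to the left leg. *)
Lemma coproduct_marked_word B :
  coproduct C (marked_word B) =
  \sum_(A : {set T} | A \subset B) tens (marked_word A) (marked_word (B :\: A)%SET).
Proof.
have -> : coproduct C (marked_word B) = \prod_m coproduct C (marked_letter B m).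
  by rewrite /marked_word (big_morph _ (@coproductM C) (@coproduct1 C)).
pose F m := if m \in B then tens (@Xhat C (k m) (s m)) (Phat (s m)) else 0.
pose G m := tens (@Phat C (s m)) (marked_letter B m).
(* Giving the unmarked letters a zero left term makes the product a uniform
   product of sums; a set [A] not included in [B] then selects a zero factor. *)
rewrite (eq_bigr (fun m => F m + G m)); last first.
  move=> m _; rewrite /F /G /marked_letter.
  by case: (m \in B); rewrite ?coproductX // coproductP add0r.
rewrite bigA_distr (bigID (fun A => A \subset B)) /=.
rewrite [X in _ + X]big1 ?addr0 => [|A /fintype.subsetPn[m mA mB]]; last first.
  by apply: (@prodr_zero_factor _ _ _ _ m); rewrite ?mem_index_enum // mA /F (negPf mB).
apply: eq_bigr => A AB; rewrite -prod_tens; apply: eq_bigr => m _.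
rewrite /F /G /marked_letter finset.inE.
by case: ifP => // mA; rewrite (fintype.subsetP AB _ mA).
Qed.

Lemma conv_powS (psi : {linear alg (Bhat C) -> C^o}) N x :
  conv_pow psi N.+2 x = tens_fun psi (conv_pow psi N.+1) (coproduct C x).
Proof.
change (tens_fun psi (tpow_fun psi N)
   (tens_map idfun (coproduct_iter C N) (coproduct C x)) =
   tens_fun psi (conv_pow psi N.+1) (coproduct C x)).
move: (coproduct C x); elim/alg_ind => [|c [a b] y IHy]; first by rewrite !linear0.
rewrite !linearP IHy; congr (_ + _); congr (_ *: _).
by rewrite /tens_map /tens_fun -[amon _]/(tens a b) !tlift_tens.
Qed.

Lemma conv_pow_marked_word (psi : {linear alg (Bhat C) -> C^o}) N B :
  conv_pow psi N.+1 (marked_word B) =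
  subset_conv_pow (fun A => psi (marked_word A) : C) N.+1 B.
Proof.
elim: N B => [|N IHN] B; first by rewrite subset_conv_pow1.
rewrite conv_powS coproduct_marked_word linear_sum subset_conv_powS; apply: eq_bigr => A _.
rewrite -IHN; exact: tlift_tens.
Qed.

End MarkedWords.
Arguments marked_word {C T} k s B.
Arguments marked_letter {C T} k s B m.

Lemma dilation_prodX (C : numClosedFieldType) (T : Type) (r : seq T) (k : T -> nat) (s : T -> set nat) N :
  dilation N (\prod_(m <- r) @Xhat C (k m) (s m))
  = sqrtC (N%:R : C) ^- size r *: \prod_(m <- r) @Xhat C (k m) (s m).
Proof.
have -> : \prod_(m <- r) @Xhat C (k m) (s m) = @amon C (Bhat C) [seq LX (k m) (s m) | m <- r].
  elim: r => [|m r IHr]; first by rewrite big_nil -amon1.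
  by rewrite big_cons IHr -amonM.
rewrite dilation_amon; congr (_ ^- _ *: _).
by elim: r => //= m r ->.
Qed.

(** * The state on words with one or two marked letters *)

(** Cuts a noncommutative product over the ordinals at its two marked letters. *)
Lemma index_enum_ord_split2 n (i j : 'I_n) : (i < j)%N ->
  exists r1 r2 r3 : seq 'I_n, [/\ index_enum 'I_n = r1 ++ i :: r2 ++ j :: r3,
    forall m, m \in r1 -> (m < i)%N, forall m, (m \in r2) = (i < m < j)%N
    & forall m, m \in r3 -> (j < m)%N].
Proof.
move=> ij.
have : pairwise (fun x y : 'I_n => x < y)%N (index_enum 'I_n).
  have -> : index_enum 'I_n = enum 'I_n by rewrite [RHS]enumT /index_enum unlock.
  rewrite -(pairwise_map (@nat_of_ord n) ltn) val_enum_ord.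
  by rewrite -(sorted_pairwise ltn_trans) iota_ltn_sorted.
have : forall m, m \in index_enum 'I_n by exact: mem_index_enum.
have := mem_index_enum i; case/path.splitPr=> r1 r' memE pw.
have : j \in r'.
  have := memE j; rewrite mem_cat inE => /or3P[jr|/eqP ji|//].
    move: pw; rewrite pairwise_cat => /and3P[/allrelP/(_ j i jr)].
    by rewrite mem_head => /(_ isT)/ltn_trans/(_ ij); rewrite ltnn.
  by rewrite ji ltnn in ij.
move=> jr'; case/path.splitPr: jr' pw memE => r2 r3.
rewrite pairwise_cat pairwise_cons pairwise_cat pairwise_cons allrel_consr all_cat /=.
rewrite (allrel_consr _ r2) => /and3P[/andP[/allP lt1 _] _].
case/andP=> /and3P[/allP lt2i _ _] /and3P[/andP[/allP lt2j _] _ /andP[/allP lt3 _]] memE.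
exists r1, r2, r3; split=> // m; apply/idP/andP => [mr|[im mj]].
  by rewrite (lt2i _ mr) (lt2j _ mr).
move: (memE m); rewrite mem_cat inE mem_cat inE -!val_eqE /=.
rewrite (gtn_eqF im) (ltn_eqF mj) /=; case/or3P=> // [/lt1|/lt3].
  by rewrite ltnNge (ltnW im).
by rewrite ltnNge (ltnW mj).
Qed.

Section Moments.
Context (C : numClosedFieldType) (phi : {linear {poly C} -> C^o}).

Lemma boolean_ext_PX (b : bool) : boolean_ext phi (Pb C ^+ b) = 1.
Proof. by case: b; [exact: boolean_extP | exact: boolean_ext1]. Qed.

Lemma boolean_ext_Y (a b : bool) :
  boolean_ext phi (Pb C ^+ a * (Yb C * Pb C ^+ b)) = phi 'X.
Proof.
have := boolean_ext_word phi a b (isT : (0 < 1)%N) (isT : all (leq 1) [::]).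
by rewrite !big_nil !mulr1 -mulrA => ->.
Qed.

Lemma boolean_ext_YPY (a c b : bool) :
  boolean_ext phi (Pb C ^+ a * (Yb C * (Pb C ^+ c * (Yb C * Pb C ^+ b)))) =
  if c then phi 'X * phi 'X else phi 'X^2.
Proof.
case: c.
  have := boolean_ext_word phi a b (isT : (0 < 1)%N) (isT : all (leq 1) [:: 1%N]).
  by rewrite !big_seq1 !expr1 => <-; rewrite !mulrA.
have := boolean_ext_word phi a b (isT : (0 < 2)%N) (isT : all (leq 1) [::]).
by rewrite !big_nil !mulr1 => <-; rewrite mul1r expr2 !mulrA.
Qed.

Section Sites.
Context (T : finType) (k : T -> nat) (s : T -> set nat).
Implicit Types (B : {set T}) (r : seq T).

Definition site_letter B (j : nat) (m : T) : alg (YP C) :=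
  if m \in B then site_fun (k m) (Yb C) j else off_site C (s m) j.

(** The state is a product state, so it is a product over the sites; the site
    [j] is singled out because one site decides the value in all cases below. *)
Lemma hat_state_marked_word B j :
  hat_state phi (marked_word k s B) =
  (boolean_ext phi (\prod_m site_letter B j m) : C) *
  \big[*%R/1]_(i \in ~` [set j]%classic) (boolean_ext phi (\prod_m site_letter B i m) : C).
Proof.
suff [z ez vz] : exists2 z : itensor C, hat_eta C (marked_word k s B) = itens z
    & forall i, val z i = \prod_m site_letter B i m.
  have -> : hat_state phi (marked_word k s B) =
      infinite_tensor_fun (boolean_ext1 phi) (boolean_extP phi)
        (hat_eta C (marked_word k s B)) by [].
  rewrite ez infinite_tensor_fun_itens (it_funE (boolean_ext1 phi) (boolean_extP phi) j).
  by rewrite vz; congr (_ * _); apply: eq_fsbigr => i _; rewrite vz.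
rewrite /marked_word; elim: (index_enum T) => [|m r [z ez vz]].
  exists (it_one C) => [|i]; first by rewrite big_nil eta1 -amon1.
  by rewrite big_nil.
have [x ex vx] : exists2 x : itensor C, hat_eta C (marked_letter k s B m) = itens x
    & forall i, val x i = site_letter B i m.
  rewrite /marked_letter /site_letter; case: (m \in B).
    by rewrite etaX; eexists; first reflexivity.
  by rewrite etaP; eexists; first reflexivity.
exists (it_mul x z) => [|i]; last by rewrite /= big_cons vx vz.
by rewrite big_cons etaM ex ez /itens -amonM.
Qed.

Lemma prod_site_letter B j r : (forall m, m \in r -> m \in B -> k m != j) ->
  \prod_(m <- r) site_letter B j m =
  Pb C ^+ has (fun m => (m \notin B) && (j \notin s m)) r.
Proof.
elim: r => [|m r IHr] Hr; first by rewrite big_nil.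
rewrite big_cons IHr => [|m' m'r]; last by apply: Hr; rewrite inE m'r orbT.
have Hm := Hr m (mem_head _ _); rewrite /= {1}/site_letter.
case: (boolP (m \in B)) Hm => [_ /(_ isT) kmj|_ _] /=.
  by rewrite /site_fun eq_sym (negPf kmj) mul1r.
rewrite /off_site; case: (j \in s m); first by rewrite mul1r.
by case: (has _ _); rewrite ?mulr1 // expr1 PbPb.
Qed.

Lemma hat_state_marked_word0 : hat_state phi (marked_word k s finset.set0) = 1.
Proof.
have site1 j : boolean_ext phi (\prod_m site_letter finset.set0 j m) = 1.
  by rewrite prod_site_letter ?boolean_ext_PX // => m _; rewrite finset.inE.
by rewrite (hat_state_marked_word _ 0%N) site1 mul1r fsbig1.
Qed.

(** The site [k i] carries a single Y, so it contributes the mean. *)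
Lemma hat_state_isolated B i : phi 'X = 0 -> i \in B ->
  (forall m, m \in B -> k m = k i -> m = i) ->
  hat_state phi (marked_word k s B) = 0.
Proof.
move=> phi0 iB isoB; rewrite (hat_state_marked_word _ (k i)).
have := index_enum_uniq T; have := mem_index_enum i.
case/path.splitPr=> r1 r2 ur.
have noti m : m \in r1 ++ r2 -> m \in B -> k m != k i.
  move=> mr mB; apply: contraTN mr => /eqP/(isoB _ mB) ->.
  by have := ur; rewrite -cat1s uniq_catCA cat1s cons_uniq => /andP[].
rewrite big_cat big_cons !prod_site_letter; last 2 first.
- by move=> m mr; apply: noti; rewrite mem_cat mr orbT.
- by move=> m mr; apply: noti; rewrite mem_cat mr.
by rewrite {1}/site_letter iB /site_fun eqxx boolean_ext_Y phi0 mul0r.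
Qed.
End Sites.
Arguments site_letter {T} k s B j m.
Arguments hat_state_marked_word {T} k s B j.

(** Only the site [k j] carries Y, twice.  A projection between the two Y, which
    comes from an [m] between [i] and [j] with [k j] outside [s m], makes the
    Boolean extension factorize; without one it sees Y^2. *)
Lemma hat_state_pair n (k : 'I_n -> nat) (s : 'I_n -> set nat) (i j : 'I_n) :
  (i < j)%N -> k i = k j ->
  hat_state phi (marked_word k s [set i; j]%SET) =
  if [forall m : 'I_n, (i < m < j)%N ==> (k j \in s m)] then phi 'X^2
  else phi 'X * phi 'X.
Proof.
move=> ij kij; rewrite (hat_state_marked_word k s _ (k j)).
rewrite fsbig1 ?mulr1 => [|l lj]; last first.
  rewrite prod_site_letter ?boolean_ext_PX // => m _.
  by rewrite !finset.inE => /orP[]/eqP->; rewrite ?kij; apply/eqP => E; apply: lj.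
have [r1 [r2 [r3 [-> lt1 mem2 lt3]]]] := index_enum_ord_split2 _ _ _ ij.
have notB m : [|| m \in r1, m \in r2 | m \in r3] -> m \notin [set i; j]%SET.
  rewrite !finset.inE -!val_eqE /= mem2.
  case/or3P=> [/lt1 mi|/andP[im mj]|/lt3 jm].
  - by rewrite !ltn_eqF // (ltn_trans mi ij).
  - by rewrite (gtn_eqF im) (ltn_eqF mj).
  - by rewrite !gtn_eqF // (ltn_trans ij jm).
have kr r : (forall m, m \in r -> [|| m \in r1, m \in r2 | m \in r3]) ->
  forall m, m \in r -> m \in [set i; j]%SET -> k m != k j.
  by move=> sr m /sr/notB/negPf ->.
pose off r := has (fun m => (m \notin [set i; j]%SET) && (k j \notin s m)) r.
have -> : \prod_(m <- r1 ++ i :: r2 ++ j :: r3) site_letter k s [set i; j]%SET (k j) m =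
    Pb C ^+ off r1 * (Yb C * (Pb C ^+ off r2 * (Yb C * Pb C ^+ off r3))).
  rewrite big_cat big_cons big_cat big_cons /=.
  rewrite !prod_site_letter; try by apply: kr => m ->; rewrite ?orbT.
  by rewrite /site_letter !finset.inE !eqxx orbT /= /site_fun kij eqxx.
rewrite boolean_ext_YPY.
rewrite -if_neg /off; congr (if _ then _ else _).
apply/hasPn/forallP => [H m|H m mr].
  apply/implyP => im; apply: contraT => kjm.
  by have := H m; rewrite mem2 notB ?mem2 ?im ?orbT // kjm => /(_ isT).
rewrite negb_and negbK; apply/orP; right.
by have := H m; rewrite -mem2 mr /= negbK.
Qed.
End Moments.

(** * Asymptotics of the weights *)

Section Limits.
Context (R : realType).
Local Notation C := (Cplx R).

Lemma cvg_inv_sqrt : (fun N => (sqrtC (N.+1%:R : C))^-1 : C) @ \oo --> (0 : C).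
Proof.
apply/cvgr0Pnorm_lt => e e0.
have e20 : 0 < e ^- 2 by rewrite invr_gt0 exprn_gt0.
have := e20; rewrite ltcE /= => /andP[/eqP im0 re0].
exists (Num.truncn (complex.Re (e ^- 2))) => // N /= leN.
have u0 : 0 < sqrtC (N.+1%:R : C) by rewrite sqrtC_gt0 ltr0n.
rewrite normfV ger0_norm ?ltW // invf_plt ?posrE //.
rewrite -(@ltr_pXn2r _ 2) ?nnegrE ?invr_ge0 ?ltW // sqrtCK exprVn.
have -> : e ^- 2 = (complex.Re (e ^- 2))%:C%C by case: (e ^- 2) im0 => a b /= ->.
have -> : (N.+1%:R : C) = (N.+1%:R)%:C%C by rewrite rmorph_nat.
rewrite ltcR; apply: lt_le_trans (truncnS_gt _) _.
by rewrite ler_nat ltnS.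
Qed.

(** A partition of [n] points without singletons has [p <= n/2] blocks, and of
    these only the pairings keep a nonzero weight: [N ^_ p] is equivalent to
    [N ^ p], so the quotient behaves like the power [n - 2p] of 1/sqrt N. *)
Lemma cvg_ffact_sqrt p n : (p.*2 <= n)%N ->
  (fun N => (N.+1 ^_ p)%:R * sqrtC (N.+1%:R : C) ^- n : C) @ \oo --> ((p.*2 == n)%:R : C).
Proof.
move=> /subnKC <-; move: (n - p.*2)%N => q.
pose u N : C := (sqrtC (N.+1%:R : C))^-1.
have u_cvg := cvg_inv_sqrt; rewrite -/u in u_cvg.
have cvg_expr (v : nat -> C) (l : C) m :
      v @ \oo --> l -> (fun N => v N ^+ m) @ \oo --> l ^+ m.
  move=> vl; elim: m => [|m IHm]; first exact: cvg_cst.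
  rewrite exprS; under eq_fun do rewrite exprS.
  exact: cvgM vl IHm.
have uu N : N.+1%:R * u N ^+ 2 = 1.
  by rewrite exprVn sqrtCK divff // pnatr_eq0.
have vp : (fun N => (N.+1 ^_ p)%:R * u N ^+ p.*2) @ \oo --> (1 : C).
  elim: p => [|p IHp].
    under eq_fun do rewrite ffactn0 expr0 mulr1.
    exact: cvg_cst.
  under eq_fun do rewrite ffactnSr natrM doubleS -addn2 exprD mulrACA.
  suff step : (fun N => (N.+1 - p)%:R * u N ^+ 2) @ \oo --> (1 : C).
    by have := cvgM IHp step; rewrite mulr1; apply.
  have : (fun N => 1 - p%:R * u N ^+ 2) @ \oo --> (1 - p%:R * 0 ^+ 2 : C).
    exact: cvgB (cvg_cst (1 : C)) (cvgM (cvg_cst (p%:R : C)) (cvg_expr _ _ _ u_cvg)).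
  rewrite expr0n mulr0 subr0; apply: cvg_trans; apply: near_eq_cvg.
  exists p => // N /= pN.
  by rewrite natrB ?(leqW pN) // mulrBl uu.
have -> : (p.*2 == p.*2 + q)%N%:R = 1 * 0 ^+ q :> C.
  by rewrite -{1}[p.*2]addn0 eqn_add2l eq_sym mul1r expr0n.
have -> : (fun N => (N.+1 ^_ p)%:R * sqrtC (N.+1%:R : C) ^- (p.*2 + q) : C) =
   (fun N => ((N.+1 ^_ p)%:R * u N ^+ p.*2) * u N ^+ q).
  by apply: funext => N; rewrite -exprVn exprD mulrA.
exact: cvgM vp (cvg_expr _ _ _ u_cvg).
Qed.
End Limits.

(** * The central limit theorem for set functions *)

Definition is_pairing {T : finType} (P : {set {set T}}) : bool :=
  [forall B in P, #|B| == 2].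

Lemma partition_card_double {T : finType} (P : {set {set T}}) :
  finset.partition P [set: T]%SET -> (forall B, B \in P -> 1 < #|B|)%N ->
  (#|P|.*2 <= #|T|)%N /\ (#|P|.*2 == #|T|)%N = is_pairing P.
Proof.
move=> PT P2; have := finset.card_partition PT; rewrite cardsT => ->.
have -> : #|P|.*2 = (\sum_(B in P) 2)%N by rewrite sum_nat_const muln2.
have le2 : forall B, B \in P -> (2 <= #|B| ?= iff (#|B| == 2))%N.
  by move=> B /P2 B2; split=> //; rewrite eq_sym.
have := leqif_sum le2; rewrite -/(is_pairing P) => -[-> ->]; split => //.
Qed.

Section CentralLimit.
Context (R : realType).
Local Notation C := (Cplx R).

(** The exponential formula reduces this to one partition at a time, where
    either the product vanishes or [cvg_ffact_sqrt] applies. *)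
Lemma subset_conv_pow_clt (T : finType) (M : {set T} -> C) :
  M finset.set0 = 1 -> (forall t, M [set t]%SET = 0) ->
  (fun N => sqrtC (N.+1%:R : C) ^- #|T| * subset_conv_pow M N.+1 [set: T]%SET : C) @ \oo
  --> (\sum_(P : {set {set T}} | finset.partition P [set: T]%SET && is_pairing P)
        \prod_(A in P) M A : C).
Proof.
move=> M0 M1.
under eq_fun do rewrite subset_conv_powE // big_distrr /=.
rewrite big_mkcondr.
apply: cvg_big => [|P PT]; first exact: add_continuous.
have [/existsP[B /andP[BP /negPf B2]]|] := boolP [exists B in P, ~~ (1 < #|B|)%N].
  have MB : \prod_(A in P) M A = 0.
    have : #|B| == 1%N.
      rewrite eqn_leq lt0n cards_eq0 (finset.partition_neq0 PT BP) andbT.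
      by rewrite leqNgt B2.
    by case/finset.cards1P => t Bt; rewrite (bigD1 B) //= Bt M1 mul0r.
  rewrite MB if_same; under eq_fun do rewrite !mulr0.
  exact: cvg_cst.
move=> /existsPn P2.
have {}P2 B : B \in P -> (1 < #|B|)%N.
  by move=> BP; have := P2 B; rewrite BP /= negbK.
have [leP eqP] := partition_card_double _ PT P2.
have := cvgM (cvg_ffact_sqrt R _ _ leP) (cvg_cst (\prod_(A in P) M A)).
rewrite eqP.
have -> : (is_pairing P)%:R * \prod_(A in P) M A =
   (if is_pairing P then \prod_(A in P) M A else 0).
  by case: is_pairing; rewrite ?mul1r ?mul0r.
have -> : (fun N : nat => (N.+1 ^_ #|P|)%:R / sqrtC N.+1%:R ^+ #|T|) \* cst (\prod_(A in P) M A)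
  = (fun N => sqrtC (N.+1%:R : C) ^- #|T| * ((N.+1 ^_ #|P|)%:R * \prod_(A in P) M A)).
  by apply: funext => N /=; rewrite mulrA [_^-1 * _]mulrC.
by apply.
Qed.
End CentralLimit.

(** * Adapted pairings *)

Section AdaptedBlocks.
Context (n : nat) (k : 'I_n -> nat) (s : 'I_n -> set nat).

(** Adaptedness is a condition on each block separately, which is why the
    product of the block values is its indicator. *)
Definition adapted_block (B : {set 'I_n}) : bool :=
  [forall i in B, forall j in B, k i == k j] &&
  [forall i in B, forall j in B, forall m : 'I_n,
     [&& i < m, m < j & m \notin B]%N ==> (k i == k j) && (k j \in s m)].

Lemma adaptedE P : adapted k s P = [forall B in P, adapted_block B].
Proof.
apply/andP/'forall_implyP => [[/'forall_implyP H1 /'forall_implyP H2] B BP|H].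
  by rewrite /adapted_block H1 ?H2.
by split; apply/'forall_implyP => B /H/andP[].
Qed.

Lemma hat_state_pair_block (C : numClosedFieldType) (phi : {linear {poly C} -> C^o})
    (B : {set 'I_n}) : phi 'X = 0 -> phi 'X^2 = 1 -> #|B| == 2 ->
  hat_state phi (marked_word k s B) = (adapted_block B)%:R.
Proof.
move=> phi1 phi2 /finset.cards2P[i0 [j0 [ij0 ->]]].
have [i [j [ij ->]]] : exists i j : 'I_n, (i < j)%N /\ [set i0; j0]%SET = [set i; j]%SET.
  case: (ltngtP i0 j0) => [lt|lt|/val_inj e]; last by rewrite e eqxx in ij0.
    by exists i0, j0.
  by exists j0, i0; rewrite finset.setUC.
have [iB jB] : i \in [set i; j]%SET /\ j \in [set i; j]%SET by rewrite !finset.inE !eqxx orbT.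
have [kij|kij] := eqVneq (k i) (k j); last first.
  rewrite (hat_state_isolated _ _ _ _ _ _ i) // => [|m]; last first.
    by rewrite !finset.inE => /orP[]/eqP-> // /eqP; rewrite eq_sym (negPf kij).
  rewrite /adapted_block; case: 'forall_implyP => //= H.
  by have /'forall_implyP/(_ j jB) := H i iB; rewrite (negPf kij).
rewrite hat_state_pair // phi1 phi2 mulr0.
have -> : adapted_block [set i; j]%SET = [forall m : 'I_n, (i < m < j)%N ==> (k j \in s m)].
  apply/andP/forallP => [[_ /'forall_implyP/(_ i iB)/'forall_implyP/(_ j jB)/forallP H] m|H].
    apply/implyP => /andP[im mj]; have := H m; rewrite im mj /= !finset.inE -!val_eqE /=.
    by rewrite (gtn_eqF im) (ltn_eqF mj) => /andP[].
  have kB i' j' : i' \in [set i; j]%SET -> j' \in [set i; j]%SET -> k i' == k j'.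
    by rewrite !finset.inE => /orP[]/eqP-> /orP[]/eqP->; rewrite ?kij.
  split; apply/'forall_implyP => i' i'B; apply/'forall_implyP => j' j'B; first exact: kB.
  apply/forallP => m; apply/implyP => /and3P[im mj _]; rewrite kB //=.
  move: (H m) im mj i'B j'B; rewrite !finset.inE.
  have lt_irr x : (x < m)%N -> (m < x)%N -> False.
    by move=> xm /(ltn_trans xm); rewrite ltnn.
  move=> Hm im mj /orP[]/eqP ei /orP[]/eqP ej; rewrite !{}ei !{}ej in im mj *.
  - by case: (lt_irr _ im mj).
  - by move: Hm; rewrite im mj.
  - by case: (lt_irr _ im (ltn_trans mj ij)).
  - by case: (lt_irr _ im mj).
by case: ifP.
Qed.
End AdaptedBlocks.
Arguments adapted_block {n} k s B.

(** The square is the fully marked word of two equal letters, with nothing in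
    between. *)
Lemma hat_stateXX (C : numClosedFieldType) (phi : {linear {poly C} -> C^o}) k s :
  hat_state phi (Xhat k s ^+ 2) = phi 'X^2.
Proof.
have -> : Xhat k s ^+ 2 = marked_word (fun _ : 'I_2 => k) (fun=> s) [set ord0; ord_max]%SET
  :> alg (Bhat C).
  rewrite /marked_word !big_ord_recl big_ord0 mulr1 expr2.
  by rewrite /marked_letter !finset.inE.
rewrite hat_state_pair //.
by case: ifPn => // /forallPn[[[|[|m]] lm]].
Qed.

Theorem theorem5p3 (R : realType) (n : nat) (n_gt0 : (0 < n)%N)
    (k : 'I_n -> nat) (s : 'I_n -> set nat)
    (phi : {linear {poly (Cplx R)} -> (Cplx R)^o}) (phi_state : poly_state phi)
    (mean0 : forall i, hat_state phi (Xhat (k i) (s i)) = 0)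
    (var1 : forall i, hat_state phi (Xhat (k i) (s i) ^+ 2) = 1) :
  (~~ odd n ->
     (fun N => conv_pow (hat_state phi) N
        (dilation N (\prod_(i < n) Xhat (k i) (s i))) : Cplx R) @ \oo
     --> (#|adapted_pair_partitions k s|%:R : Cplx R)) /\
  (odd n ->
     (fun N => conv_pow (hat_state phi) N
        (dilation N (\prod_(i < n) Xhat (k i) (s i))) : Cplx R) @ \oo
     --> (0 : Cplx R)).
Proof.
have phi1 : phi 'X = 0 by have := mean0 (Ordinal n_gt0); rewrite hat_stateX.
have phi2 : phi 'X^2 = 1 by have := var1 (Ordinal n_gt0); rewrite hat_stateXX.
pose M B : Cplx R := hat_state phi (marked_word k s B).
have M0 : M finset.set0 = 1 by exact: hat_state_marked_word0.
have M1 i : M [set i]%SET = 0.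
  apply: (hat_state_isolated _ _ _ _ _ _ i) => //; first by rewrite finset.inE.
  by move=> m; rewrite finset.inE => /eqP.
have wordE : \prod_(i < n) Xhat (k i) (s i) = marked_word k s [set: 'I_n]%SET :> alg (Bhat (Cplx R)).
  by apply: eq_bigr => i _; rewrite /marked_letter finset.inE.
have powE N : conv_pow (hat_state phi) N.+1 (dilation N.+1 (\prod_(i < n) Xhat (k i) (s i)))
    = sqrtC (N.+1%:R : Cplx R) ^- n * subset_conv_pow M N.+1 [set: 'I_n]%SET.
  rewrite dilation_prodX linearZ wordE conv_pow_marked_word.
  have -> : size (index_enum 'I_n) = n.
    by rewrite -[RHS]card_ord cardE enumT /index_enum unlock.
  by [].
have limE : \sum_(P : {set {set 'I_n}} | finset.partition P [set: 'I_n]%SET && is_pairing P)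
    \prod_(A in P) M A = #|adapted_pair_partitions k s|%:R.
  rewrite -sum1_card natr_sum big_mkcond [RHS]big_mkcond; apply: eq_bigr => P _.
  rewrite finset.inE adaptedE -/(is_pairing P).
  case: (finset.partition P _) => //=.
  have [/'forall_implyP P2|_] := boolP (is_pairing P); last by rewrite andbF.
  rewrite andbT.
  transitivity (\prod_(A in P) (adapted_block k s A)%:R : Cplx R).
    by apply: eq_bigr => A /P2; exact: hat_state_pair_block.
  case: ifPn => [/'forall_implyP okP|/forallPn[A]].
    by rewrite big1 // => A /okP ->.
  by rewrite negb_imply => /andP[AP /negPf nokA]; rewrite (bigD1 A) //= nokA mul0r.
have lim : (fun N => conv_pow (hat_state phi) N
        (dilation N (\prod_(i < n) Xhat (k i) (s i))) : Cplx R) @ \oo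
     --> (#|adapted_pair_partitions k s|%:R : Cplx R).
  (* [powE] describes the convolution powers from the first one on. *)
  rewrite -cvg_shiftS -limE; under eq_fun do rewrite powE.
  have := subset_conv_pow_clt R _ M M0 M1; rewrite card_ord; exact.
split=> [_|odd_n]; first exact: lim.
suff P0 : adapted_pair_partitions k s = finset.set0.
  by move: lim; rewrite P0 cards0; exact.
apply/finset.setP => P; rewrite !finset.inE; apply/negP => /and3P[PT _ /'forall_implyP P2].
have := finset.card_partition PT; rewrite cardsT card_ord => nE.
move: odd_n; rewrite nE (eq_bigr (fun=> 2%N)) => [|B /P2/eqP //].
by rewrite sum_nat_const muln2 odd_double.
Qed.
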